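(* Let $k$ be a field, $S=k[x_1,\dots,x_n]$, and let $\Delta$ be a tight complex on $[n]$. Then $I_\Delta^{(2)}$ is Cohen-Macaulay.
   Context: $[n]=\{1,\dots,n\}$. A simplicial complex on $[n]$ is a collection of subsets of $[n]$ containing $\emptyset$ and closed under taking subsets; $\mathcal F(\Delta)$ is its set of facets (maximal faces); it is pure if all facets have the same cardinality. A pure simplicial complex $\Delta$ is a tight complex if there is a labelling of the vertices (by $1,\dots,n$) such that for every pair of facets $G_1,G_2$ and vertices $i\in G_1\setminus G_2$, $j\in G_2\setminus G_1$ with $i<j$ there is a vertex $j'\in G_1\setminus G_2$ such that $(G_2\setminus\{j\})\cup\{j'\}$ is a facet. $P_F$ is the prime ideal of $S$ generated by the $x_i$ with $i\notin F$; the second symbolic power of the Stanley-Reisner ideal $I_\Delta=\bigcap_{F\in\mathcal F(\Delta)}P_F$ is $I_\Delta^{(2)}=\bigcap_{F\in\mathcal F(\Delta)}P_F^2$. An ideal $I$ is Cohen-Macaulay if $S/I$ is Cohen-Macaulay. *)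

(* Defs.v *)
From HB Require Import structures.
From mathcomp Require Import all_boot all_order all_fingroup all_algebra.
From mathcomp Require Import generic_quotient ring_quotient boolp mpoly.
From mathcomp Require Import ring.

Set Implicit Arguments.
Unset Strict Implicit.
Unset Printing Implicit Defensive.

Import GRing.Theory.
Local Open Scope ring_scope.
Local Open Scope quotient_scope.

(* Following ring_quotient, an element of [idealr R] is a proper ideal and an
   element of [prime_idealr R] is a prime ideal.  Both are boolean predicates;
   `[< _ >] turns propositions into such predicates classically. *)

Section Ideals.
Variable R : comNzRingType.
Implicit Types (A I J : {pred R}) (s : seq R).

Definition ideal_gen A : {pred R} :=
  [pred x | `[< exists2 c : seq (R * R), {in c, forall q, q.2 \in A}
                & x = \sum_(q <- c) q.1 * q.2 >]].

Definition ideal_mul I J : {pred R} :=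
  ideal_gen [pred z | `[< exists x y, [/\ x \in I, y \in J & z = x * y] >]].

(* Proper ideals suffice, since the unit ideal is generated by 1. *)
Definition noetherian : Prop :=
  forall I : idealr R, exists s, I =i ideal_gen [pred x in s].

Definition maximal_ideal (m : idealr R) : Prop :=
  forall J : idealr R, {subset m <= J} -> {subset J <= m}.

Definition regular_sequence s : Prop :=
  1 \notin ideal_gen [pred x in s] /\
  forall i : nat, (i < size s)%N ->
  forall x : R, s`_i * x \in ideal_gen [pred x in take i s] ->
                x \in ideal_gen [pred x in take i s].

Definition depth_is I (d : nat) : Prop :=
  (exists s, [/\ regular_sequence s, {subset s <= I} & size s = d]) /\
  (forall s, regular_sequence s -> {subset s <= I} -> (size s <= d)%N).

(* p 0 < p 1 < ... < p r strictly; the values p i with i > r are irrelevant. *)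
Definition prime_chain (r : nat) (p : nat -> prime_idealr R) : Prop :=
  forall i : nat, (i < r)%N ->
    {subset p i <= p i.+1} /\ ~ {subset p i.+1 <= p i}.

Definition krull_dim_is (d : nat) : Prop :=
  (exists p, prime_chain d p) /\ (forall r p, prime_chain r p -> (r <= d)%N).

(* R is local with maximal ideal m (m contains every proper ideal), and
   depth R = dim R.  Only used for Noetherian R. *)
Definition cohen_macaulay_local : Prop :=
  exists2 m : idealr R, (forall J : idealr R, {subset J <= m})
    & exists2 d : nat, depth_is m d & krull_dim_is d.

End Ideals.

(* The localization R_P: fractions a / s with s \notin P, where a / s = b / t
   iff u * (a * t - b * s) = 0 for some u \notin P. *)
Section Localization.
Variables (R : comNzRingType) (P : prime_idealr R).

Definition loc_den := {s : R | s \notin P}.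

Lemma loc_den1_subproof : 1 \notin P.
Proof. by rewrite idealr1. Qed.

Lemma loc_denM_subproof (s t : loc_den) : sval s * sval t \notin P.
Proof. by rewrite prime_idealrM negb_or (svalP s) (svalP t). Qed.

Definition loc_den1 : loc_den := exist _ 1 loc_den1_subproof.
Definition loc_denM (s t : loc_den) : loc_den :=
  exist _ (sval s * sval t) (loc_denM_subproof s t).

Definition loc_equiv (x y : R * loc_den) : bool :=
  `[< exists u : loc_den, sval u * (x.1 * sval y.2 - y.1 * sval x.2) = 0 >].

Lemma loc_equivP x y :
  reflect (exists u : loc_den,
             sval u * (x.1 * sval y.2) = sval u * (y.1 * sval x.2))
          (loc_equiv x y).
Proof.
apply: (iffP (asboolP _)) => -[u Hu]; exists u.
  by apply/eqP; rewrite -subr_eq0 -mulrBr Hu.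
by rewrite mulrBr Hu subrr.
Qed.

Lemma loc_equiv_refl : reflexive loc_equiv.
Proof. by move=> x; apply/loc_equivP; exists loc_den1. Qed.

Lemma loc_equiv_sym : ssrbool.symmetric loc_equiv.
Proof.
by move=> x y; apply/loc_equivP/loc_equivP => -[u Hu]; exists u; rewrite Hu.
Qed.

Lemma loc_equiv_trans : transitive loc_equiv.
Proof.
move=> [b t] [a s] [c w] /loc_equivP[u /= Hu] /loc_equivP[v /= Hv].
apply/loc_equivP; exists (loc_denM (loc_denM u v) t) => /=.
transitivity ((sval v * sval w) * (sval u * (a * sval t)));
  first by ring.
rewrite Hu; transitivity ((sval u * sval s) * (sval v * (b * sval w)));
  first by ring.
by rewrite Hv; ring.
Qed.

Canonical loc_equiv_equiv :=
  EquivRel loc_equiv loc_equiv_refl loc_equiv_sym loc_equiv_trans.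

Definition localization := {eq_quot loc_equiv}.

HB.instance Definition _ : EqQuotient _ loc_equiv localization :=
  EqQuotient.on localization.
HB.instance Definition _ := Choice.on localization.

Definition loc_frac (a : R) (s : loc_den) : localization :=
  \pi_localization (a, s).

Lemma loc_fracP a s b t :
  loc_frac a s = loc_frac b t <->
  exists u : loc_den, sval u * (a * sval t) = sval u * (b * sval s).
Proof.
split=> [/eqmodP/loc_equivP //|H].
by apply/eqmodP/loc_equivP.
Qed.

Lemma loc_fracW (Q : localization -> Prop) :
  (forall a s, Q (loc_frac a s)) -> forall x, Q x.
Proof. by move=> H; elim/quotW => -[a s]; apply: H. Qed.

Definition loc_num (x : localization) : R := (repr x).1.
Definition loc_denom (x : localization) : loc_den := (repr x).2.

Lemma loc_fracK x : loc_frac (loc_num x) (loc_denom x) = x.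
Proof. by rewrite /loc_frac /loc_num /loc_denom -surjective_pairing reprK. Qed.

Definition loc_add (x y : localization) : localization :=
  loc_frac (loc_num x * sval (loc_denom y) + loc_num y * sval (loc_denom x))
           (loc_denM (loc_denom x) (loc_denom y)).
Definition loc_opp (x : localization) : localization :=
  loc_frac (- loc_num x) (loc_denom x).
Definition loc_mul (x y : localization) : localization :=
  loc_frac (loc_num x * loc_num y) (loc_denM (loc_denom x) (loc_denom y)).

Lemma loc_addE a s b t :
  loc_add (loc_frac a s) (loc_frac b t) =
  loc_frac (a * sval t + b * sval s) (loc_denM s t).
Proof.
have /loc_fracP[u Hu] := loc_fracK (loc_frac a s).
have /loc_fracP[v Hv] := loc_fracK (loc_frac b t).
rewrite /loc_add; apply/loc_fracP; exists (loc_denM u v) => /=.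
move: (loc_num _) (loc_denom _) Hu (loc_num _) (loc_denom _) Hv.
move=> a' s' Hu b' t' Hv.
transitivity ((sval v * sval t * sval t') * (sval u * (a' * sval s))
            + (sval u * sval s * sval s') * (sval v * (b' * sval t)));
  first by ring.
by rewrite Hu Hv; ring.
Qed.

Lemma loc_oppE a s : loc_opp (loc_frac a s) = loc_frac (- a) s.
Proof.
have /loc_fracP[u Hu] := loc_fracK (loc_frac a s).
rewrite /loc_opp; apply/loc_fracP; exists u.
by rewrite !mulNr !mulrN Hu.
Qed.

Lemma loc_mulE a s b t :
  loc_mul (loc_frac a s) (loc_frac b t) = loc_frac (a * b) (loc_denM s t).
Proof.
have /loc_fracP[u Hu] := loc_fracK (loc_frac a s).
have /loc_fracP[v Hv] := loc_fracK (loc_frac b t).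
rewrite /loc_mul; apply/loc_fracP; exists (loc_denM u v) => /=.
move: (loc_num _) (loc_denom _) Hu (loc_num _) (loc_denom _) Hv.
move=> a' s' Hu b' t' Hv.
transitivity ((sval u * (a' * sval s)) * (sval v * (b' * sval t)));
  first by ring.
by rewrite Hu Hv; ring.
Qed.

Let loc_zero := loc_frac 0 loc_den1.
Let loc_one := loc_frac 1 loc_den1.

Lemma loc_addA : associative loc_add.
Proof.
elim/loc_fracW=> a s; elim/loc_fracW=> b t; elim/loc_fracW=> c w.
by rewrite !loc_addE; apply/loc_fracP; exists loc_den1 => /=; ring.
Qed.

Lemma loc_addC : commutative loc_add.
Proof.
elim/loc_fracW=> a s; elim/loc_fracW=> b t.
by rewrite !loc_addE; apply/loc_fracP; exists loc_den1 => /=; ring.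
Qed.

Lemma loc_add0 : left_id loc_zero loc_add.
Proof.
elim/loc_fracW=> a s.
by rewrite !loc_addE; apply/loc_fracP; exists loc_den1 => /=; ring.
Qed.

Lemma loc_addN : left_inverse loc_zero loc_opp loc_add.
Proof.
elim/loc_fracW=> a s.
by rewrite loc_oppE !loc_addE; apply/loc_fracP; exists loc_den1 => /=; ring.
Qed.

HB.instance Definition _ :=
  GRing.isZmodule.Build localization loc_addA loc_addC loc_add0 loc_addN.

Lemma loc_mulA : associative loc_mul.
Proof.
elim/loc_fracW=> a s; elim/loc_fracW=> b t; elim/loc_fracW=> c w.
by rewrite !loc_mulE; apply/loc_fracP; exists loc_den1 => /=; ring.
Qed.

Lemma loc_mulC : commutative loc_mul.
Proof.
elim/loc_fracW=> a s; elim/loc_fracW=> b t.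
by rewrite !loc_mulE; apply/loc_fracP; exists loc_den1 => /=; ring.
Qed.

Lemma loc_mul1 : left_id loc_one loc_mul.
Proof.
elim/loc_fracW=> a s.
by rewrite !loc_mulE; apply/loc_fracP; exists loc_den1 => /=; ring.
Qed.

Lemma loc_mulDl : left_distributive loc_mul loc_add.
Proof.
elim/loc_fracW=> a s; elim/loc_fracW=> b t; elim/loc_fracW=> c w.
rewrite (loc_addE a s b t) !(loc_mulE _ _ c w) loc_addE.
by apply/loc_fracP; exists loc_den1 => /=; ring.
Qed.

Lemma loc_one_neq0 : loc_one != loc_zero.
Proof.
apply/eqP => /loc_fracP[u /=]; rewrite !mulr1 mulr0 => u0.
by move: (svalP u); rewrite /= u0 idealr0.
Qed.

HB.instance Definition _ := GRing.Zmodule_isComNzRing.Build localization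
  loc_mulA loc_mulC loc_mul1 loc_mulDl loc_one_neq0.

End Localization.

Definition cohen_macaulay (R : comNzRingType) : Prop :=
  noetherian R /\
  forall P : prime_idealr R, maximal_ideal P ->
    cohen_macaulay_local (localization P).

Definition cohen_macaulay_ideal (R : comNzRingType) (I : idealr R) : Prop :=
  cohen_macaulay {ideal_quot I}.

(* The vertex set [n] is 'I_n.  As usual, an i : 'I_n with [set i] not a face
   is allowed. *)
Record simplicial_complex (n : nat) := SimplicialComplex {
  faces :> {set {set 'I_n}};
  faces0 : set0 \in faces;
  faces_sub : forall F G : {set 'I_n}, F \in faces -> G \subset F -> G \in faces
}.

Section Complexes.
Variables (k : fieldType) (n : nat) (D : simplicial_complex n).

Definition facets : {set {set 'I_n}} :=
  [set F | maxset [pred G | G \in faces D] F].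

Definition pure : Prop := {in facets &, forall F G : {set 'I_n}, #|F| = #|G|}.

Definition tight : Prop :=
  pure /\
  exists l : {perm 'I_n},
    {in facets &, forall G1 G2 : {set 'I_n}, forall i j : 'I_n,
      i \in G1 :\: G2 -> j \in G2 :\: G1 -> (l i < l j)%N ->
      exists2 j' : 'I_n, j' \in G1 :\: G2 & j' |: (G2 :\ j) \in facets}.

Definition facet_ideal (F : {set 'I_n}) : {pred {mpoly k[n]}} :=
  ideal_gen [pred p | [exists i : 'I_n, (i \notin F) && (p == 'X_i)]].

Definition symbolic_square : {pred {mpoly k[n]}} :=
  [pred p | [forall F in facets,
     p \in ideal_mul (facet_ideal F) (facet_ideal F)]].

Lemma facets_nonempty : exists F, F \in facets.
Proof.
have [F mF _] := maxset_exists (P := [pred G | G \in faces D]) (faces0 D).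
by exists F; rewrite inE.
Qed.

End Complexes.

Arguments facet_ideal k {n} F.
Arguments symbolic_square k {n} D.

Section SymbolicSquareIdeal.

Lemma ideal_gen0 (R : comNzRingType) (A : {pred R}) : 0 \in ideal_gen A.
Proof. by apply/asboolP; exists [::] => //; rewrite big_nil. Qed.

Lemma ideal_genD (R : comNzRingType) (A : {pred R}) x y :
  x \in ideal_gen A -> y \in ideal_gen A -> x + y \in ideal_gen A.
Proof.
move=> /asboolP[c Hc ->] /asboolP[e He ->]; apply/asboolP.
exists (c ++ e); last by rewrite big_cat.
by move=> q; rewrite mem_cat => /orP[/Hc|/He].
Qed.

Lemma ideal_genM (R : comNzRingType) (A : {pred R}) a x :
  x \in ideal_gen A -> a * x \in ideal_gen A.
Proof.
move=> /asboolP[c Hc ->]; apply/asboolP.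
exists [seq (a * q.1, q.2) | q <- c]; first by move=> _ /mapP[q /Hc ? ->].
by rewrite big_map mulr_sumr; apply: eq_bigr => q _; rewrite mulrA.
Qed.

Variables (k : fieldType) (n : nat) (D : simplicial_complex n).
Local Notation S := {mpoly k[n]}.

Lemma facet_ideal_coeff0 F (p : S) : p \in facet_ideal k F -> p@_0%MM = 0.
Proof.
move=> /asboolP[c Hc ->]; rewrite raddf_sum big1_seq // => q /= /Hc.
move=> /existsP[i /andP[_ /eqP ->]].
by rewrite rmorphM /= mcoeffX mnm1_eq0 mulr0.
Qed.

Lemma symbolic_square_idealr : idealr_closed (symbolic_square k D).
Proof.
split.
- by apply/forall_inP => F _; apply: ideal_gen0.
- have [F FD] := facets_nonempty D; apply/negP => /forall_inP/(_ F FD).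
  move=> /asboolP[c Hc /(congr1 (mcoeff 0%MM))]; rewrite mcoeff1 eqxx raddf_sum.
  rewrite big1_seq => [/eqP|q /= /Hc]; first by rewrite oner_eq0.
  move=> /asboolP[x [y [Hx _ ->]]].
  by rewrite !rmorphM /= (facet_ideal_coeff0 Hx) mul0r mulr0.
- move=> a x y /forall_inP Hx /forall_inP Hy; apply/forall_inP => F FD.
  by apply: ideal_genD; [apply/ideal_genM/Hx | apply: Hy].
Qed.

HB.instance Definition _ :=
  isIdealr.Build S (symbolic_square k D) symbolic_square_idealr.

End SymbolicSquareIdeal.

(* Main.v *)
Require Import Defs.
From HB Require Import structures.
From mathcomp Require Import all_boot all_order all_fingroup all_algebra.
From mathcomp Require Import generic_quotient ring_quotient boolp mpoly.
From mathcomp Require Import zify ring.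
From mathcomp Require classical_sets.

Set Implicit Arguments.
Unset Strict Implicit.
Unset Printing Implicit Defensive.

Import GRing.Theory.
Local Open Scope ring_scope.
Local Open Scope quotient_scope.

(** Let S = k[x_1, ..., x_n], let I be the second symbolic power, A = S / I,
    and let d be the common cardinality of the facets.  At every maximal ideal
    of A both the depth and the dimension are shown to be d.

    _Reduction to the facets._  Call a sequence weakly regular on S / J when it
    satisfies the nonzerodivisor condition, the quotient being allowed to
    vanish.  A sequence that is weakly regular on S / (J : x) and on S / (J + x)
    is weakly regular on S / J ([wregular_extension]).  Starting from J = I this
    is applied to the variables one after the other, from the largest label
    down: the vertices already treated fall into a set Z, where the exponent is
    0, and a set V, where one factor x_v has been divided out.  The monomials
    outside the resulting ideal are governed by the facets that avoid Z and
    contain V up to one vertex.  Tightness says that the next vertex v either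
    lies in all of these facets, and then needs no treatment, or can be shed:
    each such facet F containing v has a companion that contains F - v and
    avoids v ([shedding]).  Shedding makes J + x_v an ideal of the same kind.
    When every vertex has been treated, what remains is a facet ideal P_F or a
    squarefree monomial hypersurface, which again breaks up into facet ideals.
    So a sequence that is weakly regular on all S / P_F is so on A
    ([wregular_standard0]).

    _One sequence for all facets._  By the Nullstellensatz a maximal ideal M
    contains, for each i, some g_i(x_i) with g_i monic
    ([algebraic_mod_maximal]).  Then z_i = x_i g_i(x_i) lies in M, is monic in
    x_i, and belongs to P_F when i is outside F.  The elementary symmetric
    functions e_d(z), ..., e_1(z), in this order, are weakly regular on every
    S / P_F: modulo P_F only the product over F survives in e_d, so e_d is a
    nonzerodivisor, and modulo one of its factors z_i the same argument runs
    with one variable less ([wregular_esyms]).  Hence the depth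
    of A at M is at least d.

    _Dimension._  A prime of S containing I contains some P_F, and a chain of r
    strict inclusions of primes above P_F yields, for each N, about N^r products
    of powers that are linearly independent modulo P_F and have degree O(N).
    They live in a space of dimension O(N^d), so r <= d ([prime_chain_bound]).
    Conversely a regular sequence of length r in a local ring produces a chain
    of r strict inclusions of primes ([regular_prime_chain]), so depth <= dim,
    and everything equals d.  The Noetherian condition is the Hilbert basis
    theorem ([hilbert_basis]). *)

(** * Ideals, colon ideals and weakly regular sequences *)

Section Ideals.
Variable R : comNzRingType.
Implicit Types (J : R -> Prop) (s : seq R) (a b f u x : R).

(** Ideals are predicates valued in [Prop], the unit ideal included, since
    colon ideals and sums of ideals are often improper here. *)
Definition is_ideal J :=
  [/\ J 0, forall a b, J a -> J b -> J (a + b) & forall c a, J a -> J (c * a)].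

Definition adjoin J x : R -> Prop := fun u => exists b c, J b /\ u = b + c * x.
Definition colon J x : R -> Prop := fun u => J (x * u).

Definition regular_mod J f := forall u, J (f * u) -> J u.

(** Regularity of a sequence on R / J without the condition that the sequence
    generates a proper ideal modulo J; the omission is what makes
    [wregular_extension] hold without side conditions. *)
Fixpoint wregular J s : Prop :=
  if s is f :: s' then regular_mod J f /\ wregular (adjoin J f) s' else True.

Lemma ideal0 J : is_ideal J -> J 0. Proof. by case. Qed.
Lemma idealD J a b : is_ideal J -> J a -> J b -> J (a + b).
Proof. by case=> _ D _; apply: D. Qed.
Lemma idealM J c a : is_ideal J -> J a -> J (c * a).
Proof. by case=> _ _; apply. Qed.
Lemma idealMl J a c : is_ideal J -> J a -> J (a * c).
Proof. by rewrite mulrC; apply: idealM. Qed.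
Lemma idealN J a : is_ideal J -> J a -> J (- a).
Proof. by rewrite -mulN1r; apply: idealM. Qed.
Lemma idealB J a b : is_ideal J -> J a -> J b -> J (a - b).
Proof. by move=> iJ Ja Jb; apply: idealD => //; apply: idealN. Qed.
Lemma ideal_sum J (I : Type) (r : seq I) (P : pred I) (F : I -> R) :
  is_ideal J -> (forall i, P i -> J (F i)) -> J (\sum_(i <- r | P i) F i).
Proof. by move=> iJ; apply: big_ind; [apply: ideal0|move=> a b; apply: idealD]. Qed.

Lemma set_ext (A B : R -> Prop) : (forall u, A u <-> B u) -> A = B.
Proof. by move=> AB; apply/funext => u; apply/propext. Qed.

Lemma adjoin_ideal J x : is_ideal J -> is_ideal (adjoin J x).
Proof.
move=> iJ; split.
- by exists 0, 0; split; [apply: ideal0|rewrite mul0r addr0].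
- move=> _ _ [b [c [Jb ->]]] [b' [c' [Jb' ->]]].
  by exists (b + b'), (c + c'); split; [apply: idealD|ring].
- move=> e _ [b [c [Jb ->]]]; exists (e * b), (e * c).
  by split; [apply: idealM|ring].
Qed.

Lemma sub_adjoin J x u : J u -> adjoin J x u.
Proof. by exists u, 0; rewrite mul0r addr0. Qed.

Lemma mem_adjoin J x c : is_ideal J -> adjoin J x (c * x).
Proof. by move=> iJ; exists 0, c; rewrite add0r; split=> //; apply: ideal0. Qed.

Lemma adjoinC J x y : adjoin (adjoin J x) y = adjoin (adjoin J y) x.
Proof.
suff H J' x' y' u : adjoin (adjoin J' x') y' u -> adjoin (adjoin J' y') x' u.
  by apply: set_ext => u; split; apply: H.
move=> [_ [c [[b [e [Jb ->]]] ->]]].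
exists (b + c * y'), e; split; [by exists b, c|ring].
Qed.

Lemma adjoin_congr J x y :
  is_ideal J -> J (x - y) -> adjoin J x = adjoin J y.
Proof.
move=> iJ; suff H x' y' u : J (x' - y') -> adjoin J x' u -> adjoin J y' u.
  move=> Jxy; apply: set_ext => u; split; apply: H => //.
  by rewrite -opprB; apply: idealN.
move=> Jxy [b [c [Jb ->]]]; exists (b + c * (x' - y')), c; split; last by ring.
by apply: idealD => //; apply: idealM.
Qed.

Lemma wregular_unit J s : is_ideal J -> J 1 -> wregular J s.
Proof.
elim: s J => //= f s IH J iJ J1; split.
  by move=> u _; rewrite -[u]mulr1; apply: idealM.
by apply: IH; [apply: adjoin_ideal|apply: sub_adjoin].
Qed.

(** The sequence 0 -> R/(J:x) -> R/J -> R/(J+x) -> 0 is exact.  If f is regular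
    on both ends it is regular in the middle, and the sequence stays exact
    modulo f because (J + f) : x = (J : x) + f, so the argument can be
    repeated with the next element. *)
Lemma wregular_extension s J x : is_ideal J ->
  wregular (colon J x) s -> wregular (adjoin J x) s -> wregular J s.
Proof.
elim: s J => //= f s IH J iJ [reg_colon wcolon] [reg_adj wadj].
have reg : regular_mod J f.
  move=> u Jfu; have [b [c [Jb uE]]] := reg_adj _ (sub_adjoin _ Jfu).
  suff Jxc : J (x * c) by rewrite uE; apply: idealD; rewrite // mulrC.
  apply: reg_colon; rewrite /colon.
  have -> : x * (f * c) = f * u - f * b by rewrite uE; ring.
  by apply: idealB => //; apply: idealM.
split=> //; apply: IH; [exact: adjoin_ideal| |by rewrite adjoinC].
suff -> : colon (adjoin J f) x = adjoin (colon J x) f by [].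
apply: set_ext => w; split; rewrite /colon.
  move=> [b [c [Jb xwE]]].
  have [b' [e [Jb' cE]]] : adjoin J x c.
    apply: reg_adj; exists (- b), w; split; first exact: idealN.
    by rewrite mulrC -[w * x]mulrC xwE; ring.
  exists (w - e * f), e; split; last by ring.
  have -> : x * (w - e * f) = b + f * b' by rewrite mulrBr xwE cE; ring.
  by apply: idealD => //; apply: idealM.
move=> [b [c [Jb ->]]]; exists (x * b), (x * c); split=> //; ring.
Qed.

End Ideals.

(** * Elementary symmetric functions of univariate polynomials *)

Section Univariate.
Variables (k : fieldType) (n : nat).
Local Notation S := {mpoly k[n]}.
Implicit Types (J : S -> Prop) (l : 'I_n) (g : {poly k}) (u z : S).

(** The isomorphism of S with a subring of S[X] that reads a polynomial as
    univariate in x_l; evaluation at X = x_l recovers it. *)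
Definition univ l : S -> {poly S} :=
  mmap (polyC \o @mpolyC n k) (fun i => if i == l then 'X else ('X_i)%:P).

HB.instance Definition _ l := GRing.RMorphism.on (univ l).

Lemma univX l i : univ l 'X_i = if i == l then 'X else ('X_i)%:P.
Proof. by rewrite /univ mmapX mmap1U. Qed.

Lemma univC l c : univ l c%:MP = (c%:MP)%:P.
Proof. by rewrite /univ mmapC. Qed.

Lemma univK l u : (univ l u).['X_l] = u.
Proof.
rewrite /univ /mmap [RHS]mpolyE -horner_evalE rmorph_sum /=; apply: eq_bigr => m _.
rewrite rmorphM /= !horner_evalE hornerC -mul_mpolyC; congr (_ * _).
rewrite -horner_evalE /mmap1 rmorph_prod [RHS]mpolyXE_id; apply: eq_bigr => i _.
rewrite rmorphXn /= horner_evalE; case: eqP => [->|_]; last by rewrite hornerC.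
by rewrite hornerX.
Qed.

(** The property of J shared by ideals that have generators free of x_l. *)
Definition univ_stable J l := forall u, J u -> forall j, J (univ l u)`_j.

Lemma univ_stable_adjoin J l z : is_ideal J -> univ l z = z%:P ->
  univ_stable J l -> univ_stable (adjoin J z) l.
Proof.
move=> iJ zl sJ _ [b [c [Jb ->]]] j; rewrite rmorphD rmorphM /= zl coefD coefMC.
by exists (univ l b)`_j, (univ l c)`_j; split=> //; apply: sJ.
Qed.

(** Descending induction on j: the coefficient of index j + deg p in p q is
    q_j plus multiples of coefficients of q of larger index. *)
Lemma monic_regular (R : comNzRingType) (J : R -> Prop) (p q : {poly R}) :
  is_ideal J -> p \is monic -> (forall j, J (p * q)`_j) -> forall j, J q`_j.
Proof.
move=> iJ mp Jpq j.
suff H m : forall j, (size q <= j + m)%N -> J q`_j by apply: (H (size q)); lia.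
elim: m => [|m IH] {}j le.
  by rewrite addn0 in le; rewrite nth_default //; apply: ideal0.
have [e pE] : exists e, size p = e.+1.
  by exists (size p).-1; rewrite prednK // lt0n size_poly_eq0 monic_neq0.
have := Jpq (j + e)%N; rewrite coefM.
(* The index j + e isolates the leading coefficient of p against q_j. *)
have lt : (e < (j + e).+1)%N by lia.
rewrite (bigD1 (Ordinal lt)) //=.
have -> : p`_e = 1 by move/monicP: mp; rewrite lead_coefE pE.
rewrite mul1r addnK => Js; rewrite -[q`_j](addrK (\sum_(i < (j + e).+1 | i != Ordinal lt) p`_i * q`_(j + e - i))).
apply: idealB => //; apply: ideal_sum => // i ne.
have {ne} : (i : nat) != e by apply: contra ne => /eqP ie; apply/eqP/val_inj.
case: (ltngtP (i : nat) e) => // ie _.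
  by apply: idealM => //; apply: IH; move: ie le; lia.
by rewrite [p`_i]nth_default ?mul0r ?pE //; apply: ideal0.
Qed.

Definition eval_var l g : S := (map_poly (@mpolyC n k) g).['X_l].

Lemma univ_eval_var l i g :
  univ l (eval_var i g) =
  if i == l then map_poly (@mpolyC n k) g else (eval_var i g)%:P.
Proof.
rewrite /eval_var -horner_map /= univX -map_poly_comp /=.
have -> : map_poly (univ l \o @mpolyC n k) g = map_poly (polyC \o @mpolyC n k) g.
  by apply: eq_map_poly => c /=; rewrite univC.
case: eqP => _.
  by rewrite map_poly_comp /=; apply: comp_polyXr.
by rewrite map_poly_comp /= horner_map.
Qed.

Lemma regular_eval_var J l g : is_ideal J -> g \is monic -> univ_stable J l ->
  regular_mod J (eval_var l g).
Proof.
move=> iJ mg sJ u Jgu; rewrite -(univK l u).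
have JU j : J (univ l u)`_j.
  apply: (@monic_regular _ _ (map_poly (@mpolyC n k) g)) => //.
    by rewrite map_monic.
  move=> i; have := sJ _ Jgu i.
  by rewrite rmorphM /= univ_eval_var eqxx.
by rewrite horner_coef; apply: ideal_sum => // i _; apply: idealMl.
Qed.

End Univariate.

Section ElementarySymmetric.
Variables (R : comNzRingType) (I : finType) (z : I -> R).

Definition esym j : R := \sum_(A : {set I} | #|A| == j) \prod_(i in A) z i.

(** The decreasing order e_j, ..., e_1 matters: it starts with the function
    that becomes a single product modulo the remaining variables. *)
Fixpoint esyms j : seq R := if j is j'.+1 then esym j :: esyms j' else [::].

Lemma esym_congr (J : R -> Prop) (T : {set I}) :
  is_ideal J -> (forall i, i \notin T -> J (z i)) ->
  J (esym #|T| - \prod_(i in T) z i).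
Proof.
move=> iJ Jz; rewrite /esym (bigD1 T) //= addrAC subrr add0r.
apply: ideal_sum => // A /andP[/eqP cA neAT].
have [i iA iT] : exists2 i, i \in A & i \notin T.
  apply/subsetPn; apply: contra neAT => sAT.
  by rewrite eqEcard sAT cA leqnn.
by rewrite (bigD1 i) //=; apply: idealMl => //; apply: Jz.
Qed.

(** Filter R / (J + z_1 ... z_r) by the products of fewer factors: each factor
    of the filtration is some R / (J + z_i). *)
Lemma wregular_adjoin_prod (J : R -> Prop) (s : seq R) (t : seq I) :
  is_ideal J -> (forall i, i \in t -> regular_mod J (z i)) ->
  (forall i, i \in t -> wregular (adjoin J (z i)) s) ->
  wregular (adjoin J (\prod_(i <- t) z i)) s.
Proof.
move=> iJ; elim: t => [|i t IH] reg wreg.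
  apply: wregular_unit; first exact: adjoin_ideal.
  by have := mem_adjoin 1 1 iJ; rewrite big_nil mul1r.
rewrite big_cons; set p := \prod_(j <- t) z j.
have iJp := adjoin_ideal (z i * p) iJ.
apply: (wregular_extension (x := z i) iJp).
  have -> : colon (adjoin J (z i * p)) (z i) = adjoin J p.
    apply: set_ext => u; split=> [[b [c [Jb uE]]]|[b [c [Jb ->]]]].
      exists (u - c * p), c; split; last by ring.
      apply: (reg i); rewrite ?mem_head //.
      by have -> : z i * (u - c * p) = b by rewrite mulrBr uE; ring.
    by exists (z i * b), c; split; [apply: idealM|ring].
  by apply: IH => j jt; [apply: reg|apply: wreg]; rewrite inE jt orbT.
have -> : adjoin (adjoin J (z i * p)) (z i) = adjoin J (z i).
  apply: set_ext => u; split=> [[_ [c [[b [e [Jb ->]]] ->]]]|[b [c [Jb ->]]]].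
    by exists b, (e * p + c); split; [|ring].
  by exists b, c; split; [apply: sub_adjoin|].
by apply: wreg; rewrite mem_head.
Qed.

Lemma regular_prod (J : R -> Prop) (t : seq I) :
  (forall i, i \in t -> regular_mod J (z i)) ->
  regular_mod J (\prod_(i <- t) z i).
Proof.
elim: t => [|i t IH] reg u; first by rewrite big_nil mul1r.
rewrite big_cons -mulrA => /(reg i (mem_head _ _)).
by apply: IH => j jt; apply: reg; rewrite inE jt orbT.
Qed.

Lemma regular_congr (J : R -> Prop) f g :
  is_ideal J -> J (f - g) -> regular_mod J g -> regular_mod J f.
Proof.
move=> iJ Jfg reg u Jfu; apply: reg.
have -> : g * u = f * u - (f - g) * u by ring.
by apply: idealB => //; apply: idealMl.
Qed.

End ElementarySymmetric.

Section SymmetricRegular.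
Variables (k : fieldType) (n : nat) (g : 'I_n -> {poly k}).
Hypothesis g_monic : forall i, g i \is monic.
Local Notation S := {mpoly k[n]}.
Local Notation z := (fun i => eval_var i (g i) : S).

(** Modulo J only the z_i with i in T survive, so e_j with j = #|T| is their
    product.  Modulo one further z_i the situation is the same for T minus i. *)
Lemma wregular_esyms (T : {set 'I_n}) (J : S -> Prop) :
  is_ideal J -> (forall i, i \notin T -> J (z i)) ->
  (forall l, l \in T -> univ_stable J l) -> wregular J (esyms z #|T|).
Proof.
have [j cT] : exists j, #|T| = j by exists #|T|.
rewrite cT; elim: j T J cT => // j IH T J cT iJ Jz sJ /=.
have reg i : i \in enum T -> regular_mod J (z i).
  by rewrite mem_enum => iT; apply: regular_eval_var => //; apply: sJ.
have := esym_congr iJ Jz; rewrite cT => ec.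
have pE : \prod_(i in T) z i = \prod_(i <- enum T) z i by rewrite big_enum.
rewrite pE in ec; split.
  by apply: regular_congr ec _ => //; apply: regular_prod.
rewrite (adjoin_congr iJ ec); apply: wregular_adjoin_prod => // i.
rewrite mem_enum => iT; apply: (IH (T :\ i)).
- by move: cT; rewrite (cardsD1 i T) iT add1n => -[].
- exact: adjoin_ideal.
- move=> l; rewrite !inE negb_and negbK => /orP[/eqP ->|/Jz Jl].
    by have := mem_adjoin (eval_var i (g i)) 1 iJ; rewrite mul1r.
  exact: sub_adjoin.
move=> l; rewrite !inE => /andP[li lT]; apply: univ_stable_adjoin => //.
  by rewrite univ_eval_var eq_sym (negPf li).
exact: sJ.
Qed.

End SymmetricRegular.

(** * Monomial ideals and facet ideals *)

Section MonomialIdeals.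
Variables (k : fieldType) (n : nat).
Local Notation S := {mpoly k[n]}.
Implicit Types (std : 'X_{1..n} -> bool) (p : S) (m : 'X_{1..n}) (F : {set 'I_n}).

(** The ideal is described by the monomials outside it: [std] tells the
    standard monomials, those whose classes form a basis of the quotient. *)
Definition monomial_ideal std : S -> Prop := fun p => forall m, std m -> p@_m = 0.

Definition order_ideal std := forall m m', std (m + m')%MM -> std m'.

Lemma monomial_idealP std : order_ideal std -> is_ideal (monomial_ideal std).
Proof.
move=> dc; split=> [m _|a b Ja Jb m sm|c a Ja m sm].
- by rewrite mcoeff0.
- by rewrite mcoeffD Ja // Jb // addr0.
rewrite mcoeffM big1 // => -[m1 m2] /= /eqP mE.
by rewrite Ja ?mulr0 //; apply: (dc m1); rewrite -mE.
Qed.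

(** A monomial ideal is spanned by its monomials. *)
Lemma monomial_ideal_min std (J : S -> Prop) :
  is_ideal J -> (forall m, ~~ std m -> J 'X_[m]) ->
  forall p, monomial_ideal std p -> J p.
Proof.
move=> iJ JX p sp; rewrite [p]mpolyE big_seq; apply: ideal_sum => // m.
rewrite mcoeff_msupp => pm; rewrite -mul_mpolyC; apply: idealM => //; apply: JX.
by apply: contra pm => /sp ->.
Qed.

Lemma monomial_idealX std m : ~~ std m -> monomial_ideal std 'X_[m].
Proof.
by move=> sm m' sm'; rewrite mcoeffX; case: eqP sm' => // <-; rewrite (negPf sm).
Qed.

Lemma monomial_ideal_colon std v :
  colon (monomial_ideal std) 'X_v = monomial_ideal (fun m => std (U_(v) + m)%MM).
Proof.
apply: set_ext => p; split=> sp m sm.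
  by rewrite -(sp _ sm) mulrC mcoeffMX.
rewrite mulrC; have [mv|mv] := eqVneq (m v) 0%N.
  apply/memN_msupp_eq0; rewrite (perm_mem (msuppMX _ _)).
  apply/mapP => -[m' _ mE]; move: mv; rewrite mE mnmDE mnm1E eqxx; lia.
have mE : m = (U_(v) + (m - U_(v)))%MM by rewrite addmC submK // lep1mP.
by rewrite mE mcoeffMX; apply: sp; rewrite -mE.
Qed.

Lemma monomial_ideal_adjoin std v : order_ideal std ->
  adjoin (monomial_ideal std) 'X_v = monomial_ideal (fun m => std m && (m v == 0%N)).
Proof.
move=> dc; apply: set_ext => p; split=> [[b [c [sb ->]]] m /andP[sm /eqP mv]|].
  rewrite mcoeffD sb // add0r; apply/memN_msupp_eq0.
  rewrite (perm_mem (msuppMX _ _)).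
  apply/mapP => -[m' _ mE]; move: mv; rewrite mE mnmDE mnm1E eqxx; lia.
have iA := adjoin_ideal 'X_v (monomial_idealP dc).
apply: (monomial_ideal_min iA) => m; rewrite negb_and => /orP[sm|mv].
  by apply: sub_adjoin; apply: monomial_idealX.
have -> : 'X_[m] = 'X_[m - U_(v)] * 'X_v :> S by rewrite -mpolyXD submK // lep1mP.
by apply: mem_adjoin; apply: monomial_idealP.
Qed.

Lemma eq_monomial_ideal std1 std2 :
  std1 =1 std2 -> monomial_ideal std1 = monomial_ideal std2.
Proof. by move=> /funext ->. Qed.

Definition supported (F : {set 'I_n}) m := [forall i, (i \notin F) ==> (m i == 0%N)].

Lemma supportedP F m : reflect (forall i, i \notin F -> m i = 0%N) (supported F m).
Proof.
by apply: (iffP forallP) => H i; [move/(implyP (H i))/eqP|apply/implyP=> /H ->].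
Qed.

Lemma supported_order_ideal F : order_ideal (supported F).
Proof.
move=> m m' /supportedP H; apply/supportedP => i /H; rewrite mnmDE; lia.
Qed.

Lemma supported_univ_stable F l :
  l \in F -> univ_stable (monomial_ideal (supported F)) l.
Proof.
move=> lF; set J := monomial_ideal _.
have iJ : is_ideal J by apply: monomial_idealP; apply: supported_order_ideal.
have iJ' : is_ideal (fun u : S => forall j, J (univ l u)`_j).
  split=> [j|a b Ja Jb j|c a Ja j].
  - by rewrite rmorph0 coef0; exact: ideal0 iJ.
  - by rewrite rmorphD coefD; exact: idealD iJ (Ja j) (Jb j).
  by rewrite rmorphM coefM; apply: ideal_sum => // i _; exact: idealM iJ (Ja _).
move=> u Ju; refine (monomial_ideal_min iJ' _ Ju) => m.
move=> /forallPn[i]; rewrite negb_imply => /andP[iF mi] j.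
have -> : 'X_[m] = 'X_[m - U_(i)] * 'X_i :> S by rewrite -mpolyXD submK // lep1mP.
have il : i != l by apply: contra iF => /eqP ->.
rewrite rmorphM /= univX (negPf il) coefMC; apply: (idealM _ iJ).
apply: monomial_idealX; apply/negP => /supportedP/(_ i iF).
by rewrite mnm1E eqxx.
Qed.

Variable g : 'I_n -> {poly k}.
Hypothesis g_monic : forall i, g i \is monic.
Hypothesis g_root0 : forall i, root (g i) 0.

(** The ideal of polynomials with no monomial supported in F is the facet
    ideal P_F, and it contains z_i = g_i(x_i) for i outside F because g_i
    vanishes at 0. *)
Lemma wregular_supported F :
  wregular (monomial_ideal (supported F)) (esyms (fun i => eval_var i (g i)) #|F|).
Proof.
have iJ := monomial_idealP (@supported_order_ideal F).
apply: wregular_esyms => // [i iF|]; last exact: supported_univ_stable.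
have /factor_theorem[q ->] := g_root0 i.
rewrite /eval_var rmorphM /= subr0 map_polyX hornerM hornerX.
apply: (idealM _ iJ); apply: monomial_idealX; apply/negP => /supportedP/(_ i iF).
by rewrite mnm1E eqxx.
Qed.

End MonomialIdeals.

(** * Shedding vertices of tight complexes *)

Section Exchange.
Variables (n : nat) (fac : {set {set 'I_n}}) (l : {perm 'I_n}) (d : nat).
Implicit Types (F Z V : {set 'I_n}) (v i : 'I_n) (m : 'X_{1..n}).
Hypothesis fac_card : forall F, F \in fac -> #|F| = d.
Hypothesis fac_exchange : forall G1 G2 i j, G1 \in fac -> G2 \in fac ->
  i \in G1 :\: G2 -> j \in G2 :\: G1 -> (l i < l j)%N ->
  exists2 j', j' \in G1 :\: G2 & j' |: (G2 :\ j) \in fac.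

Lemma disjoint_setU1 F v Z :
  [disjoint F & v |: Z] = (v \notin F) && [disjoint F & Z].
Proof. by rewrite !disjoints_subset setCU subsetI subsetC sub1set inE. Qed.

(** The facets that still matter once the variables in Z are set to 0 and a
    factor x_v has been divided out for each v in V. *)
Definition near_facets Z V : {set {set 'I_n}} :=
  [set F in fac | [disjoint F & Z] && (#|V :\: F| <= 1)%N].

Lemma near_facetsP Z V F :
  reflect [/\ F \in fac, [disjoint F & Z] & (#|V :\: F| <= 1)%N]
          (F \in near_facets Z V).
Proof. by rewrite inE; apply: (iffP and3P). Qed.

(** Take a facet F0 that avoids v.  If some i in F0 - F lies outside V, then i
    is not yet treated, hence has a smaller label than v, and tightness allows
    v to be exchanged in F for an element of F0.  Otherwise F0 - F is contained
    in V - F, which has at most one element, and F0 itself contains F - v. *)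
Lemma shedding Z V v F0 F :
  v \notin V ->
  (forall i, (l v < l i)%N ->
     [\/ i \in Z, i \in V | forall G, G \in near_facets Z V -> i \in G]) ->
  F0 \in near_facets Z V -> v \notin F0 ->
  F \in near_facets Z V -> v \in F ->
  exists F', [/\ F' \in near_facets Z V, v \notin F', F :\ v \subset F' &
                 (#|V :\: F'| <= #|V :\: F|)%N].
Proof.
move=> vV decided nF0 vF0 nF vF.
have /near_facetsP[fF0 dF0 cF0] := nF0; have /near_facetsP[fF dF cF] := nF.
have [/existsP[i /andP[iD iV]]|noi] := boolP [exists i, (i \in F0 :\: F) && (i \notin V)].
  have lt : (l i < l v)%N.
    move: (iD); rewrite inE => /andP[iF iF0].
    rewrite ltnNge leq_eqVlt negb_or; apply/andP; split.
      by apply: contra iF => /eqP/val_inj/perm_inj <-.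
    apply/negP => /decided[iZ|iV'|/(_ _ nF) iF'].
    - by move/disjointFr: dF0 => /(_ _ iF0); rewrite iZ.
    - by rewrite iV' in iV.
    - by rewrite iF' in iF.
  have vD : v \in F :\: F0 by rewrite inE vF0.
  have [j' jD fF'] := fac_exchange fF0 fF iD vD lt.
  move: jD; rewrite inE => /andP[jF jF0].
  have sub : V :\: (j' |: F :\ v) \subset V :\: F.
    apply/subsetP => a; rewrite !inE !negb_or negb_and negbK => /andP[/andP[_ /orP[/eqP ->|->]]] //.
    by rewrite (negPf vV).
  exists (j' |: (F :\ v)); split.
  - apply/near_facetsP; split=> //; last exact: leq_trans (subset_leq_card sub) cF.
    rewrite disjoint_subset; apply/subsetP => a; rewrite !inE => /orP[/eqP ->|/andP[_ aF]].
      by rewrite (disjointFr dF0).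
    by rewrite (disjointFr dF).
  - rewrite !inE eqxx /= orbF; apply: contra vF0 => /eqP ->//.
  - exact: subsetUr.
  - exact: subset_leq_card.
have sDV : F0 :\: F \subset V :\: F.
  apply/subsetP => i iD; move/existsPn/(_ i): noi; rewrite iD /= negbK => iV.
  by move: iD; rewrite !inE iV => /andP[->].
have cD : #|F0 :\: F| = #|F :\: F0|.
  apply/eqP; rewrite -(eqn_add2l #|F0 :&: F|) cardsID setIC cardsID.
  by rewrite !fac_card.
have vD : v \in F :\: F0 by rewrite inE vF0.
have c1 : #|F :\: F0| = 1%N.
  apply/eqP; rewrite eqn_leq -{1}cD (leq_trans (subset_leq_card sDV)) //.
  by apply/card_gt0P; exists v.
exists F0; split=> //.
  apply/subsetP => a; rewrite !inE => /andP[av aF]; apply: contraNT av => aF0.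
  have /eqP/cards1P[w wE] := c1.
  have : a \in F :\: F0 by rewrite inE aF0.
  by move: vD; rewrite wE !inE => /eqP -> /eqP ->.
apply: leq_trans cF0 _; rewrite -c1 -cD; exact: subset_leq_card.
Qed.

(** The exponent outside F after multiplication by the product of x_v over V. *)
Definition outside_weight F V (m : 'X_{1..n}) : nat :=
  \sum_(i | i \notin F) (m i + (i \in V)).

Definition standard Z V (m : 'X_{1..n}) : bool :=
  [forall i in Z, m i == 0%N] &&
  [exists F in fac, [disjoint F & Z] && (outside_weight F V m <= 1)%N].

Lemma standardP Z V m :
  reflect ((forall i, i \in Z -> m i = 0%N) /\
           exists F, [/\ F \in fac, [disjoint F & Z] & (outside_weight F V m <= 1)%N])
          (standard Z V m).
Proof.
apply: (iffP andP) => [[/forall_inP Z0 /exists_inP[F fF /andP[dF wF]]]|[Z0 [F [fF dF wF]]]].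
  by split; [move=> i /Z0/eqP|exists F].
split; first by apply/forall_inP => i /Z0 ->.
by apply/exists_inP; exists F => //; rewrite dF.
Qed.

Lemma outside_weightE F V m :
  outside_weight F V m = (\sum_(i | i \notin F) m i + #|V :\: F|)%N.
Proof.
rewrite /outside_weight big_split /=; congr (_ + _)%N.
rewrite -sum1_card big_mkcond [RHS]big_mkcond; apply: eq_bigr => i _.
by rewrite !inE; case: (i \in F); case: (i \in V).
Qed.

Lemma standard_order_ideal Z V : order_ideal (standard Z V).
Proof.
move=> m m' /standardP[Z0 [F [fF dF wF]]]; apply/standardP; split.
  by move=> i /Z0; rewrite mnmDE; lia.
exists F; split=> //; apply: leq_trans wF; apply: leq_sum => i _.
by rewrite mnmDE; lia.
Qed.

Lemma standard_shift Z V v m : v \notin Z -> v \notin V ->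
  standard Z V (U_(v) + m)%MM = standard Z (v |: V) m.
Proof.
move=> vZ vV; congr (_ && _).
  apply: eq_forallb_in => i iZ; rewrite mnmDE mnm1E.
  by have -> : (v == i) = false by apply: contraNF vZ => /eqP ->.
apply: eq_existsb => F; congr (_ && (_ && (_ <= _)%N)).
apply: eq_bigr => i _; rewrite mnmDE mnm1E !inE [i == v]eq_sym.
case: (eqVneq v i) => [iv|ne] /=; last by rewrite add0n.
by rewrite -iv (negPf vV) addn0 addnC.
Qed.

(** A facet F through v imposes no condition on the exponent of x_v.  So when
    that exponent is 0, the condition of the companion of F that avoids v is
    not stronger than that of F. *)
Lemma standard_restrict Z V v m : v \notin V ->
  (forall F, F \in near_facets Z V -> v \in F ->
    exists F', [/\ F' \in near_facets Z V, v \notin F', F :\ v \subset F' &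
                 (#|V :\: F'| <= #|V :\: F|)%N]) ->
  standard Z V m && (m v == 0%N) = standard (v |: Z) V m.
Proof.
move=> vV shed; apply/andP/standardP => [[/standardP[Z0 [F [fF dF wF]]] /eqP mv]|].
  split; first by move=> i; rewrite !inE => /orP[/eqP ->|/Z0].
  have [vF|vF] := boolP (v \in F); last first.
    by exists F; split=> //; rewrite disjoint_setU1 vF.
  have nF : F \in near_facets Z V.
    by apply/near_facetsP; split=> //; move: wF; rewrite outside_weightE; lia.
  have [F' [/near_facetsP[fF' dF' cF'] vF' sF cle]] := shed F nF vF.
  exists F'; split=> //.
    by rewrite disjoint_setU1 vF'.
  apply: leq_trans wF; rewrite !outside_weightE leq_add //.
  rewrite big_mkcond [leqRHS]big_mkcond; apply: leq_sum => i _.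
  have [->|iv] := eqVneq i v; first by rewrite vF vF' mv.
  have := subsetP sF i; rewrite !inE iv /=.
  by case: (i \in F) => [->|_] //; case: ifP.
case=> Z0 [F [fF dF wF]]; split; last by rewrite Z0 // !inE eqxx.
apply/standardP; split; first by move=> i iZ; apply: Z0; rewrite inE iZ orbT.
by exists F; split=> //; move: dF; rewrite disjoint_setU1 => /andP[].
Qed.

End Exchange.

(** * Reduction of the symbolic square to facet ideals *)

Section Filtration.
Variables (k : fieldType) (n : nat) (fac : {set {set 'I_n}}) (l : {perm 'I_n}).
Variables (d : nat) (s : seq {mpoly k[n]}).
Implicit Types (F Z V : {set 'I_n}) (v i : 'I_n).
Hypothesis fac_card : forall F, F \in fac -> #|F| = d.
Hypothesis fac_exchange : forall G1 G2 i j, G1 \in fac -> G2 \in fac ->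
  i \in G1 :\: G2 -> j \in G2 :\: G1 -> (l i < l j)%N ->
  exists2 j', j' \in G1 :\: G2 & j' |: (G2 :\ j) \in fac.
Hypothesis s_facet : forall F, F \in fac ->
  wregular (monomial_ideal (k := k) (supported F)) s.

Lemma wregular_monomial_extension std v : order_ideal std ->
  wregular (monomial_ideal (k := k) (fun m => std (U_(v) + m)%MM)) s ->
  wregular (monomial_ideal (k := k) (fun m => std m && (m v == 0%N))) s ->
  wregular (monomial_ideal (k := k) std) s.
Proof.
move=> dc wc wa; apply: (wregular_extension (x := 'X_v) (monomial_idealP k dc)).
  by rewrite monomial_ideal_colon.
by rewrite monomial_ideal_adjoin.
Qed.

Lemma wregular_pred0 : wregular (monomial_ideal (k := k) (n := n) (fun=> false)) s.
Proof. by apply: wregular_unit => //; apply: monomial_idealP. Qed.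

(** Standard monomials for the ideal generated by the variables in Z and the
    product of the variables in t. *)
Definition hypersurface Z (t : seq 'I_n) (m : 'X_{1..n}) : bool :=
  [forall i in Z, m i == 0%N] && has (fun u => m u == 0%N) t.

Lemma hypersurface_order_ideal Z t : order_ideal (hypersurface Z t).
Proof.
move=> m m' /andP[/forall_inP Z0 /hasP[u ut mu]]; apply/andP; split.
  by apply/forall_inP => i /Z0; rewrite mnmDE; lia.
by apply/hasP; exists u => //; move: mu; rewrite mnmDE; lia.
Qed.

Lemma wregular_hypersurface Z t :
  uniq t -> (forall u, u \in t -> u \notin Z /\ ~: (u |: Z) \in fac) ->
  wregular (monomial_ideal (k := k) (hypersurface Z t)) s.
Proof.
elim: t => [_ _|u t IH /= /andP[ut Ut] tP].
  have -> : hypersurface Z [::] = fun=> false by apply/funext => m; rewrite /hypersurface andbF.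
  exact: wregular_pred0.
have [uZ uF] := tP u (mem_head _ _).
apply: (@wregular_monomial_extension _ u); first exact: hypersurface_order_ideal.
  rewrite (@eq_monomial_ideal _ _ _ (hypersurface Z t)).
    by apply: IH => // u' u't; apply: tP; rewrite inE u't orbT.
  move=> m; congr (_ && _).
    apply: eq_forallb_in => i iZ; rewrite mnmDE mnm1E.
    by have -> : (u == i) = false by apply: contraNF uZ => /eqP ->.
  rewrite /= mnmDE mnm1E eqxx /=; apply: eq_in_has => u' u't.
  rewrite mnmDE mnm1E; have -> : (u == u') = false; last by [].
  by apply: contraNF ut => /eqP ->.
rewrite (@eq_monomial_ideal _ _ _ (supported (~: (u |: Z)))); first exact: s_facet.
move=> m; apply/idP/supportedP => [/andP[/andP[/forall_inP Z0 _] /eqP mu] i|m0].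
  by rewrite !inE negbK => /orP[/eqP ->|/Z0/eqP].
have mu : m u = 0%N by apply: m0; rewrite !inE eqxx.
apply/andP; split; last by rewrite mu.
apply/andP; split; last by rewrite /= mu.
by apply/forall_inP => i iZ; rewrite m0 // !inE iZ orbT.
Qed.

(** If a near facet contains V, it is the complement of Z and the ideal is
    P_F.  If not, every near facet is the complement of Z minus one vertex u
    of V, and the ideal is a hypersurface in the variables outside Z. *)
Lemma wregular_decided Z V : [disjoint Z & V] ->
  (forall i, [\/ i \in Z, i \in V | forall G, G \in near_facets fac Z V -> i \in G]) ->
  wregular (monomial_ideal (k := k) (standard fac Z V)) s.
Proof.
move=> dZV decided.
have subF F : F \in near_facets fac Z V -> F \subset ~: Z.
  by case/near_facetsP => _ dF _; rewrite -disjoints_subset.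
have near F m : F \in fac -> [disjoint F & Z] -> (outside_weight F V m <= 1)%N ->
    F \in near_facets fac Z V.
  by move=> fF dF wF; apply/near_facetsP; split=> //; move: wF; rewrite outside_weightE; lia.
have [/existsP[F /andP[nF VF]]|no] :=
    boolP [exists F, (F \in near_facets fac Z V) && (V \subset F)].
  have /near_facetsP[fF dF _] := nF.
  have FE : F = ~: Z.
    apply/eqP; rewrite eqEsubset subF //=; apply/subsetP => i; rewrite inE => iZ.
    by case: (decided i) => [iZ'|/(subsetP VF)|/(_ _ nF)] //; rewrite iZ' in iZ.
  rewrite (@eq_monomial_ideal _ _ _ (supported F)); first exact: s_facet.
  move=> m; apply/standardP/supportedP => [[Z0 _] i|m0].
    by rewrite FE inE negbK => /Z0.
  split; first by move=> i iZ; apply: m0; rewrite FE inE iZ.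
  exists F; split=> //; rewrite /outside_weight big1 // => i iF.
  by rewrite m0 //; rewrite (contraNF (subsetP VF i) iF).
(* Every near facet misses exactly one vertex of the complement of Z. *)
pose U := [set u | (u \notin Z) && (~: (u |: Z) \in fac)].
rewrite (@eq_monomial_ideal _ _ _ (hypersurface Z (enum U))); last first.
  move=> m; apply/standardP/andP => [[Z0 [F [fF dF wF]]]|].
    split; first by apply/forall_inP => i /Z0 ->.
    have nF := near F m fF dF wF.
    have /subsetPn[u uV uF] : ~~ (V \subset F).
      by apply: contra no => VF; apply/existsP; exists F; rewrite nF.
    have uZ : u \notin Z by rewrite (disjointFl dZV).
    have FE : F = ~: (u |: Z).
      apply/eqP; rewrite eqEsubset -disjoints_subset disjoint_setU1 uF dF /=.
      apply/subsetP => i; rewrite !inE negb_or => /andP[iu iZ].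
      case: (decided i) => [iZ'|iV|/(_ _ nF)//]; first by rewrite iZ' in iZ.
      apply: contraNT iu => iF; apply/eqP; have /near_facetsP[_ _] := nF.
      by move/card_le1_eqP; apply; rewrite inE ?iF ?uF.
    apply/hasP; exists u; first by rewrite mem_enum inE uZ -FE.
    move: wF; rewrite /outside_weight (bigD1 u) //= uV; lia.
  move=> [/forall_inP Z0 /hasP[u]]; rewrite mem_enum inE => /andP[uZ uF] /eqP mu.
  split; first by move=> i /Z0/eqP.
  exists (~: (u |: Z)); split=> //.
    by rewrite disjoints_subset setCS subsetUr.
  rewrite /outside_weight (bigD1 u) /= ?inE ?eqxx // mu big1 ?addn0; first by case: (u \in V).
  move=> i; rewrite !inE negbK => /andP[/orP[->//|iZ] _].
  by rewrite (eqP (Z0 i iZ)) (disjointFr dZV).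
apply: wregular_hypersurface; first exact: enum_uniq.
by move=> u; rewrite mem_enum inE => /andP[].
Qed.

(** Downward induction on labels; the vertices of label at least j have been
    treated.  The next vertex lies in all near facets, or splits the quotient
    into the two cases of exponent 0 and exponent at least 1. *)
Lemma wregular_standard Z V j : [disjoint Z & V] ->
  (forall i, (j <= l i)%N ->
    [\/ i \in Z, i \in V | forall G, G \in near_facets fac Z V -> i \in G]) ->
  (forall i, (l i < j)%N -> i \notin Z /\ i \notin V) ->
  wregular (monomial_ideal (k := k) (standard fac Z V)) s.
Proof.
elim: j Z V => [|j IH] Z V dZV decided fresh.
  by apply: wregular_decided => // i; apply: decided.
have [ltjn|lenj] := ltnP j n; last first.
  by apply: IH => // i le; [apply: decided; have := ltn_ord (l i); lia|apply: fresh; lia].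
pose v := (l^-1)%g (Ordinal ltjn).
have lv : l v = j :> nat by rewrite permKV.
have [vZ vV] : v \notin Z /\ v \notin V by apply: fresh; rewrite lv.
have vE i : (j <= l i)%N -> i = v \/ (j < l i)%N.
  rewrite leq_eqVlt => /orP[/eqP je|]; [left|by right].
  by apply: (@perm_inj _ l); apply: val_inj; rewrite /= lv.
have [cone|/forall_inPn[F0 nF0 vF0]] := boolP [forall F in near_facets fac Z V, v \in F].
  apply: IH => // i le; last by apply: fresh; lia.
  case: (vE _ le) => [->|/decided//]; constructor 3 => G; exact: (forall_inP cone).
have shed := shedding fac_card fac_exchange vV _ nF0 vF0.
have ltv i : (l i < j)%N -> i != v by apply: contraL => /eqP ->; rewrite lv ltnn.
apply: (@wregular_monomial_extension _ v); first exact: standard_order_ideal.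
  rewrite (@eq_monomial_ideal _ _ _ (standard fac Z (v |: V))); last first.
    by move=> m; apply: standard_shift.
  apply: IH.
  - by rewrite disjoint_setU1 vZ.
  - move=> i /vE[->|/decided[iZ|iV|iG]].
    + by constructor 2; rewrite setU11.
    + by constructor 1.
    + by constructor 2; rewrite inE iV orbT.
    constructor 3 => G /near_facetsP[fG dG cG]; apply: iG; apply/near_facetsP.
    by split=> //; apply: leq_trans cG; apply/subset_leq_card/setSD/subsetUr.
  - move=> i lt; have [|iZ iV] := fresh i _; first lia.
    by rewrite !inE negb_or iZ iV ltv.
rewrite (@eq_monomial_ideal _ _ _ (standard fac (v |: Z) V)); last first.
  move=> m; apply: standard_restrict => // F nF vF.
  apply: shed => // i; rewrite lv; exact: decided.
apply: IH.
- by rewrite disjoint_sym disjoint_setU1 vV disjoint_sym.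
- move=> i /vE[->|/decided[iZ|iV|iG]].
  + by constructor 1; rewrite setU11.
  + by constructor 1; rewrite inE iZ orbT.
  + by constructor 2.
  constructor 3 => G /near_facetsP[fG dG cG]; apply: iG; apply/near_facetsP.
  by split=> //; move: dG; rewrite disjoint_setU1 => /andP[].
- move=> i lt; have [|iZ iV] := fresh i _; first lia.
  by rewrite !inE negb_or iZ iV ltv.
Qed.

Lemma wregular_standard0 :
  wregular (monomial_ideal (k := k) (standard fac set0 set0)) s.
Proof.
apply: (@wregular_standard _ _ n) => [|i|i _]; rewrite ?inE //.
  by rewrite disjoints_subset sub0set.
by rewrite leqNgt ltn_ord.
Qed.

End Filtration.

(** * The symbolic square as a monomial ideal *)

Section GeneratedIdeals.
Variable R : comNzRingType.
Implicit Types (A : {pred R}) (J : R -> Prop).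

Lemma ideal_gen_ideal A : is_ideal (fun u => u \in ideal_gen A).
Proof.
by split=> [|a b|c a]; [apply: ideal_gen0|apply: ideal_genD|apply: ideal_genM].
Qed.

Lemma ideal_gen_min A J u :
  is_ideal J -> (forall a, a \in A -> J a) -> u \in ideal_gen A -> J u.
Proof.
move=> iJ AJ /asboolP[c cA ->]; rewrite big_seq; apply: ideal_sum => // q /cA qA.
by apply: idealM => //; apply: AJ.
Qed.

Lemma sub_ideal_gen A a : a \in A -> a \in ideal_gen A.
Proof.
move=> aA; apply/asboolP; exists [:: (1, a)]; last by rewrite big_seq1 mul1r.
by move=> q; rewrite inE => /eqP ->.
Qed.

End GeneratedIdeals.

Section SymbolicSquare.
Variables (k : fieldType) (n : nat) (D : simplicial_complex n).
Local Notation S := {mpoly k[n]}.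
Implicit Types (F : {set 'I_n}) (p : S) (m : 'X_{1..n}).

Lemma facet_idealP F p : p \in facet_ideal k F -> monomial_ideal (supported F) p.
Proof.
have iJ := monomial_idealP k (@supported_order_ideal n F).
apply: ideal_gen_min => // _ /existsP[i /andP[iF /eqP ->]].
by apply: monomial_idealX; apply/negP => /supportedP/(_ i iF); rewrite mnm1E eqxx.
Qed.

(** A product of two elements of P_F has degree at least 2 outside F in each
    monomial; conversely such a monomial has two factors x_i, x_j with i, j
    outside F, possibly equal. *)
Lemma facet_ideal_sqrP F p :
  (p \in ideal_mul (facet_ideal k F) (facet_ideal k F)) <->
  monomial_ideal (fun m => (outside_weight F set0 m <= 1)%N) p.
Proof.
have wE m : outside_weight F set0 m = (\sum_(i | i \notin F) m i)%N.
  by rewrite outside_weightE set0D cards0 addn0.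
split.
  apply: ideal_gen_min => [|_ /asboolP[x [y [/facet_idealP xF /facet_idealP yF ->]]] m wm].
    apply: monomial_idealP => m m'; rewrite !wE; apply: leq_trans.
    by apply: leq_sum => i _; rewrite mnmDE leq_addl.
  rewrite mcoeffM big1 // => -[m1 m2] /= /eqP mE.
  have {wm} : (\sum_(i | i \notin F) bmnm m1 i + \sum_(i | i \notin F) bmnm m2 i <= 1)%N.
    rewrite -big_split; apply: leq_trans wm; rewrite wE.
    by apply: leq_sum => i _; rewrite [leqRHS](congr1 (fun m0 : 'X_{1..n} => m0 i) mE) mnmDE.
  have supp0 m0 : (\sum_(i | i \notin F) m0 i = 0)%N -> supported F m0.
    move=> /eqP; rewrite sum_nat_eq0 => /forallP H; apply/forallP => i.
    exact: H.
  move=> w1; have [w10|w10] := eqVneq (\sum_(i | i \notin F) bmnm m1 i)%N 0%N.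
    by rewrite xF ?mul0r //; apply: supp0.
  by rewrite [y@__]yF ?mulr0 //; apply: supp0; lia.
move=> sp; refine (monomial_ideal_min (ideal_gen_ideal _) _ sp) => m {sp}.
rewrite wE -ltnNge => w1.
have [i iF mi] : exists2 i, i \notin F & (0 < m i)%N.
  apply/exists_inP; apply: contraLR w1 => /exists_inPn m0.
  by rewrite big1 // => i iF; move/m0: iF; lia.
have [j jF mj] : exists2 j, j \notin F & (0 < (m - U_(i))%MM j)%N.
  apply/exists_inP; apply: contraLR w1 => /exists_inPn m0.
  rewrite (bigD1 i) //= big1 ?addn0.
    by have := m0 i iF; rewrite mnmBE mnm1E eqxx; lia.
  move=> j /andP[jF ji]; have := m0 j jF.
  by rewrite mnmBE mnm1E eq_sym (negPf ji); lia.
have -> : 'X_[m] = 'X_[m - U_(i) - U_(j)] * ('X_i * 'X_j) :> S.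
  rewrite mulrC -mulrA -!mpolyXD; congr 'X_[_].
  by rewrite [(U_(j) + _)%MM]addmC submK ?[(U_(i) + _)%MM]addmC ?submK // lep1mP -lt0n.
apply: ideal_genM; apply: sub_ideal_gen; apply/asboolP.
exists 'X_i, 'X_j; split=> //; apply: sub_ideal_gen; apply/existsP.
  by exists i; rewrite iF eqxx.
by exists j; rewrite jF eqxx.
Qed.

Lemma symbolic_squareP p :
  (p \in symbolic_square k D) <->
  monomial_ideal (standard (facets D) set0 set0) p.
Proof.
split=> [/forall_inP pD m /standardP[_ [F [fF _ wF]]]|pD].
  exact: (facet_ideal_sqrP F p).1 (pD F fF) m wF.
apply/forall_inP => F fF; apply/facet_ideal_sqrP => m wF; apply: pD.
apply/standardP; split; first by move=> i; rewrite inE.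
by exists F; split=> //; rewrite disjoint_sym disjoints_subset sub0set.
Qed.

End SymbolicSquare.

(** * The Nullstellensatz *)

(** Generation as an algebra, phrased as an induction principle, so that no
    iterated polynomial ring has to be named. *)
Definition generates (R B : comNzRingType) (f : R -> B) (us : seq B) := forall P : B -> Prop,
  (forall r, P (f r)) -> (forall u, u \in us -> P u) ->
  (forall a b, P a -> P b -> P (a + b)) -> (forall a b, P a -> P b -> P (a * b)) ->
  forall y, P y.

Section Adjunction.
Variables (R B : comNzRingType).
Implicit Types (f : {rmorphism R -> B}) (us : seq B).

Definition eval_ext f (u : B) : {rmorphism {poly R} -> B} :=
  horner_morph (fun x => mulrC u (f x)).

Lemma eval_extE f u p : eval_ext f u p = (map_poly f p).[u].
Proof. by []. Qed.

Lemma eval_extC f u r : eval_ext f u r%:P = f r.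
Proof. exact: horner_morphC. Qed.

(** One generator can be moved into the base ring; this is the step of all
    inductions over lists of generators below. *)
Lemma generates_ext f u us : generates f (u :: us) -> generates (eval_ext f u) us.
Proof.
move=> gen P Pf Pus PD PM; apply: (gen P) => //.
  by move=> r; rewrite -(eval_extC f u).
move=> v; rewrite inE => /orP[/eqP ->|]; last exact: Pus.
by have := Pf 'X; rewrite eval_extE map_polyX hornerX.
Qed.

End Adjunction.

Section Goldman.
Variable K : fieldType.

(** One element s whose powers are divisible by every nonzero element of the
    image: the image is a Goldman domain, that is, inverting s makes it a
    field. *)
Definition goldman (R : comNzRingType) (f : R -> K) := exists2 s, f s != 0 &
  forall r, f r != 0 -> exists N q, f (s ^+ N) = f (q * r).

Section Step.
Variables (R : comNzRingType) (f : {rmorphism R -> K}) (u : K).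

(** If u were transcendental, 1 + X t would divide a power of t, although it is
    coprime to t and not constant. *)
Lemma goldman_algebraic : goldman (eval_ext f u) ->
  exists2 p, map_poly f p != 0 & (map_poly f p).[u] = 0.
Proof.
move=> [t tu0 tP]; apply: contrapT => noalg.
have inj p : eval_ext f u p = 0 -> map_poly f p = 0.
  by move=> pu; apply/eqP/negPn/negP => p0; apply: noalg; exists p.
pose T := map_poly f t.
have T0 : T != 0 by apply: contraNneq tu0 => T0; rewrite eval_extE -/T T0 horner0.
have rE : map_poly f ('X * t + 1) = 'X * T + 1.
  by rewrite rmorphD rmorphM rmorph1 /= map_polyX.
have sz : (1 < size ('X * T + 1)%R)%N.
  by rewrite mulrC size_polyDl size_mulX // ?size_poly1 ltnS size_poly_gt0.
have [|N [q qE]] := tP ('X * t + 1).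
  by apply/eqP => /inj; rewrite rE => r0; move: sz; rewrite r0 size_poly0.
have : map_poly f (t ^+ N - q * ('X * t + 1)) = 0.
  by apply: inj; rewrite rmorphB /= qE subrr.
rewrite rmorphB rmorphXn rmorphM /= rE => /eqP; rewrite subr_eq0 => /eqP TE.
have cop : coprimep T ('X * T + 1) by rewrite coprimep_addl_mul coprimep1.
have : coprimep ('X * T + 1) (T ^+ N) by rewrite coprimep_expr // coprimep_sym.
move/coprimepP/(_ _ (dvdpp _)); rewrite TE dvdp_mulIr => /(_ isT).
by rewrite -size_poly_eq1 => /eqP szE; rewrite szE in sz.
Qed.

Local Notation integral := (integralOver f).

Lemma integral_exp x N : integral x -> integral (x ^+ N).
Proof.
move=> ix; elim: N => [|N IH]; first exact: integral1.
by rewrite exprS; apply: integral_mul.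
Qed.

Lemma integral_img_exp r N : integral (f r ^+ N).
Proof. by apply: integral_exp; apply: integral_id. Qed.

(** Multiplying an equation for x by a power of its leading coefficient a gives
    a monic equation for a x. *)
Lemma integral_lead (p : {poly R}) e x :
  size (map_poly f p) = e.+1 -> (map_poly f p).[x] = 0 -> integral (f p`_e * x).
Proof.
set P := map_poly f p => sP Px; set a := p`_e.
case: e sP @a => [|e] sP a.
  have [r PE] : exists r, P = r%:P.
    by exists P`_0; apply: size1_polyC; rewrite sP.
  move: Px sP; rewrite PE; by rewrite hornerC size_polyC => ->; rewrite eqxx.
pose q := 'X^(e.+1) + \poly_(i < e.+1) (p`_i * a ^+ (e - i)).
exists q.
  rewrite monicE lead_coefDl ?lead_coefXn // size_polyXn ltnS; exact: size_poly.
apply/rootP; rewrite rmorphD /= map_polyXn hornerD hornerXn.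
have -> : (map_poly f (\poly_(i < e.+1) (p`_i * a ^+ (e - i)))).[f a * x] =
   \sum_(i < e.+1) f a ^+ e * (f p`_i * x ^+ i).
  rewrite poly_def rmorph_sum horner_sum; apply: eq_bigr => i _.
  rewrite /= map_polyZ hornerZ /= map_polyXn hornerXn rmorphM rmorphXn /= exprMn.
  have -> : f a ^+ e = f a ^+ (e - i) * f a ^+ i by rewrite -exprD subnK // leq_ord.
  ring.
rewrite -mulr_sumr exprMn [in X in X + _]exprS -mulrA mulrCA -mulrDr.
move: Px; rewrite horner_coef sP big_ord_recr /= coef_map /= -/a addrC => Px.
rewrite (eq_bigr (fun i : 'I_e.+1 => P`_i * x ^+ i)) ?Px ?mulr0 //.
by move=> i _; rewrite coef_map.
Qed.

Lemma integral_scaled_eval a (q : {poly R}) :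
  integral (f a * u) -> integral (f a ^+ size q * eval_ext f u q).
Proof.
move=> iau; rewrite eval_extE.
rewrite (horner_coef_wide _ (size_poly _ _ : (size (map_poly f q) <= _)%N)) mulr_sumr.
apply: (big_ind (fun y => integral y)) => [|x y|i _].
- exact: integral0.
- exact: integral_add.
have -> : f a ^+ size q * ((map_poly f q)`_i * u ^+ i) =
    f a ^+ (size q - i) * f q`_i * (f a * u) ^+ i.
  by rewrite coef_map exprMn -{1}(subnK (ltnW (ltn_ord i))) exprD; ring.
apply: integral_mul; last exact: integral_exp.
by apply: integral_mul; [apply: integral_img_exp|apply: integral_id].
Qed.

(** An equation with constant term r, divided by x, writes r / x as a
    polynomial in x. *)
Lemma integral_scaled_inv x (c : {poly R}) : x != 0 -> integral x ->
  map_poly f c != 0 -> (map_poly f c).[x] = 0 ->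
  exists2 r, f r != 0 & integral (f r / x).
Proof.
move=> x0 ix; elim/poly_ind: c => [|c r IH]; first by rewrite rmorph0 eqxx.
rewrite rmorphD rmorphM /= map_polyX map_polyC hornerD hornerMX hornerC /=.
have [->|fr0 _ cx] := eqVneq (f r) 0.
  rewrite addr0 ?polyC0 ?addr0 mulf_eq0 negb_or => /andP[c0 _] /eqP.
  by rewrite mulf_eq0 (negPf x0) orbF => /eqP; apply: IH.
exists r => //.
have -> : f r / x = - (map_poly f c).[x].
  apply: (mulIf x0); rewrite divfK // mulNr; apply/eqP.
  by rewrite -addr_eq0 addrC cx.
apply/integral_opp/integral_horner => //.
by apply/integral_poly => i; rewrite coef_map; apply: integral_id.
Qed.

Lemma integral_div_clear x r : f r != 0 -> integral (f x / f r) ->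
  exists N q, f (x ^+ N) = f (q * r).
Proof.
move=> r0 [c mc /rootP cy].
have [e sc] : exists e, size c = e.+1.
  by exists (size c).-1; rewrite prednK // lt0n size_poly_eq0 monic_neq0.
exists e, (- \sum_(i < e) c`_i * x ^+ i * r ^+ (e - i.+1)).
have ce : c`_e = 1 by move/monicP: mc; rewrite lead_coefE sc.
move: cy; rewrite (horner_coef_wide _ (size_poly _ _ : (size (map_poly f c) <= _)%N)) sc big_ord_recr /=.
rewrite coef_map /= ce rmorph1 mul1r => /(congr1 (fun z => z * f r ^+ e)).
rewrite mul0r mulrDl expr_div_n divfK ?expf_neq0 // addrC => /eqP.
rewrite addr_eq0 rmorphXn => /eqP ->; rewrite mulNr rmorphN /=; congr (- _).
rewrite !mulr_suml rmorph_sum; apply: eq_bigr => i _.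
rewrite coef_map !rmorphM !rmorphXn /= expr_div_n.
have -> : f r ^+ e = f r ^+ (e - i.+1) * f r * f r ^+ i.
  by rewrite -exprSr -exprD -subSn ?subSS ?subnK // ltnW.
by field; rewrite expf_neq0.
Qed.

(** Every r divides a power of t in R[u].  Clearing the denominators of u and
    of 1/t shows that (a b)^L / r is integral over R for some L, with a and b
    independent of r; the integral equation then says that r divides a power of
    a b in R itself. *)
Lemma goldman_step : goldman (eval_ext f u) -> goldman f.
Proof.
move=> Gu; have [p P0 Pu] := goldman_algebraic Gu; have [t tu0 tP] := Gu.
have [e sP] : exists e, size (map_poly f p) = e.+1.
  by exists (size (map_poly f p)).-1; rewrite prednK // lt0n size_poly_eq0.
pose a := p`_e.
have a0 : f a != 0.
  by move: P0; rewrite -lead_coef_eq0 lead_coefE sP /= coef_map.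
have iau : integral (f a * u) := integral_lead sP Pu.
pose x := f a ^+ size t * eval_ext f u t.
have x0 : x != 0 by rewrite mulf_neq0 ?expf_neq0.
have ix : integral x by apply: integral_scaled_eval.
have [c mc /rootP cx] := ix.
have [|b b0 ib] := integral_scaled_inv x0 ix _ cx.
  by rewrite monic_neq0 // monic_map.
exists (a * b) => [|r r0]; first by rewrite rmorphM mulf_neq0.
have [|N [q qE]] := tP r%:P; first by rewrite eval_extC.
have /(integral_div_clear r0)[N' [q' q'E]] : integral (f ((a * b) ^+ (size q + N)) / f r).
  have -> : f ((a * b) ^+ (size q + N)) / f r =
    f a ^+ size q * eval_ext f u q * (f b / x) ^+ N * f a ^+ (size t * N)
      * f a ^+ N * f b ^+ size q.
    have yE : eval_ext f u q = eval_ext f u t ^+ N / f r.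
      by rewrite -rmorphXn /= qE rmorphM /= eval_extC mulfK.
    rewrite rmorphXn rmorphM /= exprMn !exprD expr_div_n yE [x ^+ N]exprMn -exprM.
    by field; rewrite r0 !expf_neq0.
  do 3!(apply: integral_mul; last exact: integral_img_exp).
  by apply: integral_mul; [apply: integral_scaled_eval|apply: integral_exp].
by exists ((size q + N) * N')%N, q'; rewrite exprM.
Qed.

End Step.

(** A field is a Goldman domain, and the property descends from R[u] to R. *)
Lemma generated_goldman us (R : comNzRingType) (f : {rmorphism R -> K}) :
  generates f us -> goldman f.
Proof.
elim: us R f => [|u us IH] R f gen; last first.
  by apply: (@goldman_step _ _ u); apply: IH; apply: generates_ext.
have surj y : exists r, y = f r.
  move: y; apply: gen => // [r|_ _ [r ->] [r' ->]|_ _ [r ->] [r' ->]].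
  - by exists r.
  - by exists (r + r'); rewrite rmorphD.
  - by exists (r * r'); rewrite rmorphM.
exists 1 => [|r r0]; first by rewrite rmorph1 oner_neq0.
have [q qE] := surj (f r)^-1.
by exists 1%N, q; rewrite expr1 rmorph1 rmorphM -qE mulVf.
Qed.

(** Zariski's lemma, in the form that each generator is algebraic. *)
Lemma generated_algebraic (k : fieldType) (f : {rmorphism k -> K}) u us :
  generates f (u :: us) -> exists2 g, g \is monic & (map_poly f g).[u] = 0.
Proof.
move=> /generates_ext/generated_goldman/goldman_algebraic[p p0 pu].
rewrite map_poly_eq0 in p0.
exists ((lead_coef p)^-1 *: p); first by rewrite monicE lead_coefZ mulVf ?lead_coef_eq0.
by rewrite map_polyZ hornerZ pu mulr0.
Qed.

End Goldman.

(** * The Hilbert basis theorem *)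

Section HilbertBasis.

Definition ideals_finitely_generated (R : comNzRingType) := forall J : R -> Prop,
  is_ideal J -> exists2 s : seq R, forall a, a \in s -> J a &
                forall u, J u -> u \in ideal_gen [pred x in s].

Variable R : comNzRingType.
Hypothesis fgR : ideals_finitely_generated R.

(** The coefficients of index n of the members of degree at most n, zero
    included; they increase with n. *)
Definition lead_ideal (J : {poly R} -> Prop) n : R -> Prop :=
  fun a => exists p, [/\ J p, (size p <= n.+1)%N & p`_n = a].

Lemma lead_idealP J n : is_ideal J -> is_ideal (lead_ideal J n).
Proof.
move=> iJ; split.
- by exists 0; split; [apply: ideal0|rewrite size_poly0|rewrite coef0].
- move=> _ _ [p [Jp sp <-]] [q [Jq sq <-]]; exists (p + q); split.
  + exact: idealD.
  + by apply: leq_trans (size_polyD _ _) _; rewrite geq_max sp.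
  + by rewrite coefD.
- move=> c _ [p [Jp sp <-]]; exists (c%:P * p); split.
  + exact: idealM.
  + by rewrite mul_polyC; apply: leq_trans (size_scale_leq _ _) sp.
  + by rewrite coefCM.
Qed.

Lemma lead_ideal_shift J n m a : is_ideal J -> (n <= m)%N ->
  lead_ideal J n a -> lead_ideal J m a.
Proof.
move=> iJ /subnK <- [p [Jp sp pa]]; exists ('X^(m - n) * p); split.
- exact: idealM.
- apply/leq_sizeP => j lt; rewrite coefXnM; case: ltnP => // _.
  by rewrite nth_default //; apply: leq_trans sp _; lia.
- by rewrite coefXnM ltnNge leq_addr /= addKn.
Qed.

Lemma lead_ideal_gens J n : is_ideal J -> exists s : seq {poly R},
  (forall p, p \in s -> J p /\ (size p <= n.+1)%N) /\
  forall a, lead_ideal J n a -> a \in ideal_gen [pred x in [seq p`_n | p : {poly R} <- s]].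
Proof.
move=> iJ; have [t tJ tgen] := fgR (lead_idealP n iJ).
suff [s sJ st] : exists2 s : seq {poly R},
    (forall p, p \in s -> J p /\ (size p <= n.+1)%N) & [seq p`_n | p : {poly R} <- s] = t.
  by exists s; rewrite st.
elim: t tJ {tgen} => [|a t IH] tJ; first by exists [::].
have [|s sJ <-] := IH; first by move=> b bt; apply: tJ; rewrite inE bt orbT.
have [p [Jp sp <-]] := tJ a (mem_head _ _).
by exists (p :: s) => // q; rewrite inE => /orP[/eqP ->|/sJ].
Qed.

(** The leading ideals become stationary from some N on.  Members of J with
    leading coefficients generating the leading ideal, taken for each degree up
    to N, generate J: the leading term can be removed repeatedly. *)
Lemma hilbert_basis : ideals_finitely_generated {poly R}.
Proof.
move=> J iJ.
have iL : is_ideal (fun a => exists n, lead_ideal J n a).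
  split.
  - by exists 0%N; apply: ideal0; apply: lead_idealP.
  - move=> a b [n La] [m Lb]; exists (maxn n m); apply: idealD.
    + exact: lead_idealP.
    + exact: lead_ideal_shift (leq_maxl _ _) La.
    + exact: lead_ideal_shift (leq_maxr _ _) Lb.
  - by move=> c a [n La]; exists n; apply: idealM; [apply: lead_idealP|].
have [t tL tgen] := fgR iL.
have [N tN] : exists N, forall a, a \in t -> lead_ideal J N a.
  elim: t tL {tgen} => [|a t IH] tL; first by exists 0%N.
  have [|N tN] := IH; first by move=> b bt; apply: tL; rewrite inE bt orbT.
  have [M aM] := tL a (mem_head _ _); exists (maxn N M) => b.
  rewrite inE => /orP[/eqP ->|/tN].
    exact: lead_ideal_shift (leq_maxr _ _) aM.
  exact: lead_ideal_shift (leq_maxl _ _).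
have stable n a : lead_ideal J n a -> lead_ideal J (minn n N) a.
  move=> La; have [//|lt] := leqP n N.
  apply: ideal_gen_min (tgen a _); last by exists n.
    exact: lead_idealP.
  exact: tN.
have /choice[B BP] := fun n => lead_ideal_gens n iJ.
pose G := flatten [seq B e | e <- iota 0 N.+1].
have BG e p : (e <= N)%N -> p \in B e -> p \in G.
  by move=> le pe; apply/flattenP; exists (B e) => //; apply: map_f; rewrite mem_iota.
exists G => [p /flattenP[_ /mapP[e _ ->] /((BP e).1 _)[]]//|p Jp].
have [n le] : exists n, (size p <= n)%N by exists (size p).
elim: n p le Jp => [|n IH] p le Jp.
  by move: le; rewrite leqn0 size_poly_eq0 => /eqP ->; apply: ideal_gen0.
set e := minn n N.
have iH : is_ideal (fun a => exists q, [/\ q \in ideal_gen [pred x in G],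
     J q, (size q <= e.+1)%N & q`_e = a]).
  split.
  - exists 0; split; [exact: ideal_gen0|exact: ideal0|by rewrite size_poly0|].
    by rewrite coef0.
  - move=> _ _ [q [Gq Jq sq <-]] [r [Gr Jr sr <-]]; exists (q + r); split.
    + exact: ideal_genD.
    + exact: idealD.
    + by apply: leq_trans (size_polyD _ _) _; rewrite geq_max sq.
    + by rewrite coefD.
  - move=> c _ [q [Gq Jq sq <-]]; exists (c%:P * q); split.
    + exact: ideal_genM.
    + exact: idealM.
    + by rewrite mul_polyC; apply: leq_trans (size_scale_leq _ _) sq.
    + by rewrite coefCM.
have [q [Gq Jq sq qe]] : exists q, [/\ q \in ideal_gen [pred x in G],
     J q, (size q <= e.+1)%N & q`_e = p`_n].
  have Lp : lead_ideal J e p`_n by apply: stable; exists p.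
  refine (ideal_gen_min iH _ ((BP e).2 _ Lp)) => a /mapP[r re ->].
  have [Jr sr] := (BP e).1 _ re.
  exists r; split=> //; apply: sub_ideal_gen; exact: BG (geq_minr _ _) re.
have le_en : (e <= n)%N := geq_minl _ _.
rewrite -[p](subrK ('X^(n - e) * q)); apply: ideal_genD; last exact: ideal_genM.
apply: IH; last by apply: idealB => //; apply: idealM.
apply/leq_sizeP => j; rewrite leq_eqVlt coefB coefXnM => /orP[/eqP <-|lt].
  by rewrite ltnNge leq_subr /= subKn // qe subrr.
rewrite nth_default ?(leq_trans le) // sub0r; case: ifP => _; rewrite ?oppr0 //.
by rewrite nth_default ?oppr0 //; apply: leq_trans sq _; lia.
Qed.

End HilbertBasis.

Lemma field_ideals_finitely_generated (k : fieldType) : ideals_finitely_generated k.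
Proof.
move=> J iJ; have [J1|J1] := pselect (J 1).
  exists [:: 1] => [a|u _]; first by rewrite inE => /eqP ->.
  by rewrite -[u]mulr1; apply: ideal_genM; apply: sub_ideal_gen; rewrite inE.
exists [::] => // u Ju; have [->|u0] := eqVneq u 0; first exact: ideal_gen0.
by case: J1; rewrite -(mulVf u0); apply: idealM.
Qed.

(** Algebras of finite type over R inherit the property from R. *)
Lemma generated_ideals_finitely_generated (B : comNzRingType) us
    (R : comNzRingType) (f : {rmorphism R -> B}) :
  ideals_finitely_generated R -> generates f us -> ideals_finitely_generated B.
Proof.
elim: us R f => [|u us IH] R f fgR gen; last first.
  exact: IH (hilbert_basis fgR) (generates_ext gen).
have surj y : exists r, y = f r.
  move: y; apply: gen => // [r|_ _ [r ->] [r' ->]|_ _ [r ->] [r' ->]].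
  - by exists r.
  - by exists (r + r'); rewrite rmorphD.
  - by exists (r * r'); rewrite rmorphM.
move=> J iJ; have iJf : is_ideal (fun r => J (f r)).
  split=> [|a b Ja Jb|c a Ja].
  - by rewrite rmorph0; apply: ideal0 iJ.
  - by rewrite rmorphD; apply: idealD iJ Ja Jb.
  - by rewrite rmorphM; apply: idealM iJ Ja.
have [s sJ sgen] := fgR _ iJf.
exists [seq f a | a <- s] => [_ /mapP[a /sJ Ja ->]//|y].
have [r ->] := surj y => /sgen rg.
refine (ideal_gen_min (J := fun r => f r \in ideal_gen _) _ _ rg) => [|a]; last first.
  by rewrite inE => as_; apply: sub_ideal_gen; apply: map_f.
split=> [|a b|c a].
- by rewrite rmorph0; apply: ideal_gen0.
- by rewrite rmorphD; apply: ideal_genD.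
- by rewrite rmorphM; apply: ideal_genM.
Qed.

Lemma ideals_finitely_generated_noetherian (R : comNzRingType) :
  ideals_finitely_generated R -> noetherian R.
Proof.
move=> fg I; have iI : is_ideal (fun u => u \in I).
  split=> [|a b|c a]; [exact: idealr0|exact: rpredD|exact: idealMr].
have [s sI sgen] := fg _ iI; exists s => u; apply/idP/idP; first exact: sgen.
by apply: (ideal_gen_min iI) => a; apply: sI.
Qed.

(** * The dimension of the coordinate rings of facets *)

Section Dimension.
Variables (k : fieldType) (n : nat).
Local Notation S := {mpoly k[n]}.
Implicit Types (p q : S -> Prop) (N : nat).

Definition is_prime (R : comNzRingType) (J : R -> Prop) :=
  [/\ is_ideal J, ~ J 1 & forall a b, J (a * b) -> J a \/ J b].

Definition prime_chain_upto (R : comNzRingType) r (p : nat -> R -> Prop) :=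
  (forall i, (i <= r)%N -> is_prime (p i)) /\
  (forall i, (i < r)%N -> (forall u, p i u -> p i.+1 u) /\ exists2 u, p i.+1 u & ~ p i u).

Definition independent_mod p (B : finType) (w : B -> S) :=
  forall c : B -> k, p (\sum_b c b *: w b) -> forall b, c b = 0.

Lemma prime_exp (R : comNzRingType) (J : R -> Prop) f j :
  is_prime J -> J (f ^+ j) -> J f.
Proof.
move=> [_ J1 JM]; elim: j => [/J1//|j IH]; rewrite exprS => /JM[//|]; exact: IH.
Qed.

(** In a relation between the f^j w_b modulo p, factor out the lowest power of
    f.  As f is not in the prime p, the cofactor lies in p, hence in q, and
    modulo q the terms of higher order in f disappear. *)
Lemma independent_mod_powers p q (B : finType) (w : B -> S) f N :
  is_prime p -> is_ideal q -> (forall u, p u -> q u) -> q f -> ~ p f ->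
  independent_mod q w ->
  independent_mod p (fun jb : 'I_N * B => f ^+ jb.1 * w jb.2).
Proof.
move=> pp iq pq qf pf ind c pc; have [ip _ pM] := pp.
pose g (j : 'I_N) := \sum_b c (j, b) *: w b.
have gE : \sum_jb c jb *: (f ^+ jb.1 * w jb.2) = \sum_(j < N) f ^+ j * g j.
  rewrite (eq_bigr (fun jb : 'I_N * B => c (jb.1, jb.2) *: (f ^+ jb.1 * w jb.2)));
    last by case.
  rewrite -(pair_bigA _ (fun (j : 'I_N) b => c (j, b) *: (f ^+ j * w b))) /=.
  apply: eq_bigr => j _; rewrite mulr_sumr; apply: eq_bigr => b _.
  by rewrite scalerAr.
rewrite gE in pc.
suff H m (j : 'I_N) : (j < m)%N -> forall b, c (j, b) = 0 by case=> j b; exact: (H j.+1).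
elim: m j => // m IH j; rewrite ltnS leq_eqVlt => /orP[/eqP jm|]; last exact: IH.
apply: ind; rewrite -/(g j).
pose h := \sum_(i < N | (j < i)%N) f ^+ (i - j.+1) * g i.
have hE : \sum_(i < N) f ^+ i * g i = f ^+ j * (g j + f * h).
  rewrite (bigID (fun i : 'I_N => (j < i)%N)) /= addrC mulrDr; congr (_ + _).
    rewrite (bigD1 j) ?ltnn //= [X in _ + X]big1 ?addr0 // => i /andP[].
    rewrite -leqNgt leq_eqVlt => /orP[/eqP/val_inj->|lt _]; first by rewrite eqxx.
    rewrite /g big1 ?mulr0 // => b _; rewrite IH ?scale0r //; lia.
  rewrite mulrA -exprSr mulr_sumr; apply: eq_bigr => i lt.
  by rewrite mulrA -exprD subnKC.
move: pc; rewrite hE => /pM[/(prime_exp pp)//|/pq qh].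
by rewrite -[g j](addrK (f * h)); apply: idealB => //; apply: idealMl.
Qed.

(** Each inclusion of the chain contributes a factor N to the size of an
    independent family and a multiple of N to the degrees. *)
Lemma chain_independent r (p : nat -> S -> Prop) : prime_chain_upto r p ->
  exists c, forall N, (0 < N)%N -> exists (B : finType) (w : B -> S),
    [/\ #|B| = (N ^ r)%N, independent_mod (p 0%N) w &
        forall b, (msize (w b) <= c * N)%N].
Proof.
elim: r p => [|r IH] p [pP pS].
  exists 1%N => N N0; exists unit, (fun=> 1); split.
  - by rewrite card_unit.
  - move=> c; rewrite (bigD1 tt) //= big1 ?addr0 => [|[]//] pc [].
    have [ip p1 _] := pP 0%N isT.
    apply: contrapT => /eqP c0; apply: p1.
    have := idealM ((c tt)^-1)%:MP ip pc.
    by rewrite -mul_mpolyC mulr1 -mpolyCM mulVf.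
  - by rewrite msize1 mul1n.
have [|c cP] := IH (fun i => p i.+1).
  by split=> [i le|i lt]; [apply: pP|apply: pS].
have [p01 [f f1 f0]] := pS 0%N isT.
(* The degree of f^j w_b is at most N msize f plus that of w_b; the constant 3
   absorbs the off-by-one terms of the size of a product. *)
exists (msize f + 3 + c)%N => N N0; have [B [w [cB ind wle]]] := cP N N0.
exists ('I_N * B)%type, (fun jb : 'I_N * B => f ^+ jb.1 * w jb.2); split.
- by rewrite card_prod card_ord cB expnS.
- apply: independent_mod_powers ind => //; first exact: pP.
  by case: (pP 1%N isT).
- move=> [j b] /=; have := wle b; have lt := ltn_ord j.
  have fle i : (msize (f ^+ i) <= i * (msize f + 1) + 1)%N.
    elim: i => [|i IHi]; first by rewrite msize1.
    rewrite exprS mulSn; apply: leq_trans (msizeM_le _ _) _; lia.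
  move=> wb; apply: leq_trans (msizeM_le _ _) _.
  have : (j * (msize f + 1) <= N * (msize f + 1))%N by rewrite leq_mul2r ltnW ?orbT.
  move: wb (fle j); rewrite /=; move: (mmeasure _ (w b)) (mmeasure _ (f ^+ j)) => W A.
  move: (mmeasure _ f) (nat_of_ord j) => M J; rewrite !mulnDl !mulnDr; lia.
Qed.

(** Modulo P_F only the monomials in the variables of F count, and there are
    at most D^|F| of them with all exponents below D. *)
Lemma dependent_mod_facet (F : {set 'I_n}) D (B : finType) (w : B -> S) :
  (D ^ #|F| < #|B|)%N -> (forall b, (msize (w b) <= D)%N) ->
  ~ independent_mod (monomial_ideal (supported F)) w.
Proof.
move=> lt wD ind.
pose T := {ffun {i | i \in F} -> 'I_D}.
pose mon (t : T) : 'X_{1..n} :=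
  [multinom (if insub i is Some j then val (t j) else 0%N) | i < n].
have cT : #|T| = (D ^ #|F|)%N by rewrite card_ffun card_ord card_sig.
pose M := \matrix_(b < #|B|, t < #|T|) (w (enum_val b))@_(mon (enum_val t)).
have : kermx M != 0.
  rewrite kermx_eq0 /row_free; apply/negP => /eqP rk.
  by have := rank_leq_col M; rewrite rk cT leqNgt lt.
move=> /rowV0Pn[v /sub_kermxP vM v0].
have sE : \sum_b v 0 (enum_rank b) *: w b = \sum_i v 0 i *: w (enum_val i).
  rewrite (reindex_onto enum_val enum_rank) => [|b _]; last exact: enum_rankK.
  by apply: eq_big => i; rewrite enum_valK // eqxx.
case/eqP: v0; apply/rowP => i; rewrite mxE -(enum_valK i).
apply: (ind (fun b => v 0 (enum_rank b))); rewrite sE {i} => m /supportedP mF; rewrite raddf_sum /=.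
have [ltm|lem] := ltnP (mdeg m) D; last first.
  apply: big1 => i _; rewrite mcoeffZ memN_msupp_eq0 ?mulr0 //.
  by apply/negP => /msize_mdeg_lt; have := wD (enum_val i); lia.
have mD i : (m i < D)%N.
  by apply: leq_ltn_trans ltm; rewrite mdegE (bigD1 i) //= leq_addr.
pose t : T := [ffun j => Ordinal (mD (val j))].
have -> : m = mon t.
  apply/mnmP => i; rewrite mnmE; case: insubP => [j _ ji|/mF//].
  by rewrite ffunE /= ji.
have := congr1 (fun A : 'rV_#|T| => A 0 (enum_rank t)) vM.
rewrite mxE [RHS]mxE => vMt; apply: etrans vMt; apply: eq_bigr => i _.
by rewrite mcoeffZ !mxE enum_rankK.
Qed.

(** N^r independent elements fit in a space of dimension (c N)^|F|, for each
    N; the value N = c^|F| + 1 already gives the bound. *)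
Lemma prime_chain_bound r (p : nat -> S -> Prop) (F : {set 'I_n}) : prime_chain_upto r p ->
  (forall u, monomial_ideal (supported F) u -> p 0%N u) -> (r <= #|F|)%N.
Proof.
move=> pr Fp; have [c cP] := chain_independent pr; set d := #|F|.
rewrite leqNgt; apply/negP => lt.
have [|B [w [cB ind wle]]] := cP (c ^ d).+1; first by [].
apply: (@dependent_mod_facet F (c * (c ^ d).+1) _ w) => //; last first.
  by move=> a /Fp; apply: ind.
have le : ((c ^ d).+1 ^ d.+1 <= (c ^ d).+1 ^ r)%N.
  by rewrite leq_pexp2l.
by rewrite cB expnMn -/d; apply: leq_trans le; rewrite expnS ltn_mul2r expn_gt0 /=.
Qed.

End Dimension.

(** * Prime ideals and regular sequences *)

Section PrimeSeparation.
Variable R : comNzRingType.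
Implicit Types (J q : R -> Prop) (T : R -> Prop) (s : seq R).

(** Krull: an ideal maximal among those containing J and disjoint from the
    multiplicative set T is prime. *)
Lemma prime_separation J T : is_ideal J ->
  T 1 -> (forall a b, T a -> T b -> T (a * b)) -> (forall a, J a -> ~ T a) ->
  exists p, [/\ is_prime p, forall a, J a -> p a & forall a, p a -> ~ T a].
Proof.
move=> iJ T1 TM JT.
pose good (I : R -> Prop) := [/\ is_ideal I, forall a, J a -> I a & forall a, I a -> ~ T a].
have goodJ : good J by split.
pose P (I : R -> Prop) := (exists a, I a) -> good I.
have [F FP totF [a0 [I0 F0 I0a]]|I [PI maxI]] := @classical_sets.Zorn_bigcup R P.
  have gF X a : F X -> X a -> good X by move=> FX Xa; apply: FP => //; exists a.
  have [i0 JI0 _] := gF I0 a0 F0 I0a.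
  split=> [|a Ja|a [X FX Xa]]; last by case: (gF X a FX Xa) => _ _; apply.
    split=> [|a b [X FX Xa] [Y FY Yb]|c a [X FX Xa]].
    - by exists I0 => //; apply: ideal0.
    - have [iX _ _] := gF X a FX Xa; have [iY _ _] := gF Y b FY Yb.
      have [XY|YX] := totF X Y FX FY.
        by exists Y => //; apply: idealD => //; apply: XY.
      by exists X => //; apply: idealD => //; apply: YX.
    - by exists X => //; case: (gF X a FX Xa) => iX _ _; apply: idealM.
  by exists I0 => //; apply: JI0.
have maxI' X : good X -> (forall a, I a -> X a) -> forall a, X a -> I a.
  move=> gX IX; apply: contrapT => nXI; apply: (maxI X) => //.
have [iI JI IT] : good I.
  apply: PI; apply: contrapT => noI; case: (noI); exists 0.
  apply: (maxI' J goodJ); last exact: ideal0.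
  by move=> a Ia; case: noI; exists a.
have meets a : ~ I a -> exists2 t, T t & adjoin I a t.
  move=> nIa; apply: contrapT => no.
  have ga : good (adjoin I a).
    split=> [|b Jb|b ab Tb]; [exact: adjoin_ideal|exact/sub_adjoin/JI|].
    by apply: no; exists b.
  apply: nIa; apply: (maxI' _ ga); first by move=> b; apply: sub_adjoin.
  by have := mem_adjoin a 1 iI; rewrite mul1r.
exists I; split=> //; split=> // [/IT//|a b Iab].
apply: contrapT => /not_orP[/meets[t1 Tt1 [c [e [Ic t1E]]]] /meets[t2 Tt2 [c' [e' [Ic' t2E]]]]].
apply: (IT (t1 * t2)); last exact: TM.
have -> : t1 * t2 = t2 * c + (e * a) * c' + e * e' * (a * b) by rewrite t1E t2E; ring.
by do !apply: idealD => //; apply: idealM.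
Qed.

(** From a prime p containing J + f one gets a smaller prime over J that does
    not contain f: J is disjoint from the products f^i t with t outside p, as f
    is a nonzerodivisor modulo J. *)
Lemma regular_prime_chain s J q : is_ideal J -> wregular J s ->
  is_prime q -> (forall a, foldl (@adjoin R) J s a -> q a) ->
  exists p, [/\ prime_chain_upto (size s) p, forall a, J a -> p 0%N a & p (size s) = q].
Proof.
elim: s J => [|f s IH] J iJ /= reg pq Jq; first by exists (fun=> q); split.
have [regf wreg] := reg.
have [p [[pP pS] Jp pE]] := IH _ (adjoin_ideal f iJ) wreg pq Jq.
have pp0 := pP 0%N isT; have [ip0 p01 p0M] := pp0.
pose T a := exists i t, ~ p 0%N t /\ a = f ^+ i * t.
have regX i t : J (f ^+ i * t) -> J t.
  by elim: i => [|i IHi]; rewrite ?mul1r // exprS -mulrA => /regf.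
have [|a b|a Ja|p' [pp' Jp' p'T]] := @prime_separation J T iJ.
- by exists 0%N, 1; rewrite mul1r.
- move=> [i [t [nt ->]]] [j [u [nu ->]]]; exists (i + j)%N, (t * u).
  by split; [case/p0M|rewrite exprD; ring].
- by move=> [i [t [nt aE]]]; apply/nt/Jp/sub_adjoin/(regX i); rewrite -aE.
exists (fun i => if i is i'.+1 then p i' else p'); split=> //.
split=> [[|i]//|[_|i]]; [exact: pP| |exact: pS].
split=> [u p'u|].
  by apply: contrapT => nu; apply: (p'T u) => //; exists 0%N, u; rewrite mul1r.
exists f; first by apply: Jp; have := mem_adjoin f 1 iJ; rewrite mul1r.
by move=> p'f; apply: (p'T f) => //; exists 1%N, 1; rewrite mulr1.
Qed.

Lemma wregularP J s : wregular J s <->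
  forall i, (i < size s)%N -> regular_mod (foldl (@adjoin R) J (take i s)) s`_i.
Proof.
elim: s J => [|f s IH] J; split=> //=.
  by move=> [reg /IH w] [|i]; [rewrite take0|apply: w].
move=> H; split; first by have := H 0%N isT; rewrite take0.
by apply/IH => i lt; apply: (H i.+1).
Qed.

Lemma foldl_adjoin_ideal J s : is_ideal J -> is_ideal (foldl (@adjoin R) J s).
Proof. by elim: s J => //= f s IH J iJ; apply/IH/adjoin_ideal. Qed.

Lemma foldl_adjoin_sub J s u : J u -> foldl (@adjoin R) J s u.
Proof. by elim: s J => //= f s IH J Ju; apply/IH/sub_adjoin. Qed.

Lemma foldl_adjoin_min J s q : is_ideal q -> (forall u, J u -> q u) ->
  (forall a, a \in s -> q a) -> forall u, foldl (@adjoin R) J s u -> q u.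
Proof.
elim: s J => //= f s IH J iq Jq sq; apply: IH => //.
  move=> _ [b [c [Jb ->]]]; apply: idealD => //; first exact: Jq.
  by apply: idealM => //; apply: sq; rewrite mem_head.
by move=> a as_; apply: sq; rewrite inE as_ orbT.
Qed.

Lemma zero_ideal : is_ideal (fun u : R => u = 0).
Proof.
by split=> [//|a b -> ->|c a ->]; rewrite ?addr0 ?mulr0.
Qed.

Lemma foldl_adjoinE s :
  foldl (@adjoin R) (fun u => u = 0) s = (fun u => u \in ideal_gen [pred x in s]).
Proof.
apply: set_ext => u; split.
  move=> su; refine (foldl_adjoin_min (ideal_gen_ideal _) _ _ su).
    by move=> _ ->; apply: ideal_gen0.
  by move=> a as_; apply: sub_ideal_gen.
apply: (ideal_gen_min (foldl_adjoin_ideal s zero_ideal)) => a.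
elim: s (fun u : R => u = 0) zero_ideal => //= f s IH J iJ.
rewrite inE => /orP[/eqP ->|]; last by apply: IH; apply: adjoin_ideal.
by apply: foldl_adjoin_sub; have := mem_adjoin f 1 iJ; rewrite mul1r.
Qed.

Lemma regular_sequenceP s : regular_sequence s <->
  1 \notin ideal_gen [pred x in s] /\ wregular (fun u => u = 0) s.
Proof.
split=> -[s1 reg]; split=> //.
  by apply/wregularP => i lt u; rewrite foldl_adjoinE; apply: reg.
by move=> i lt u; have := (wregularP _ _).1 reg i lt u; rewrite foldl_adjoinE.
Qed.

(** The primality proof is an argument so that the predicate can carry the
    structure of a prime ideal. *)
Definition prime_pred q (pq : is_prime q) : {pred R} := fun u => `[< q u >].

Lemma prime_pred_idealr q (pq : is_prime q) : idealr_closed (prime_pred pq).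
Proof.
have [iq q1 _] := pq; split.
- by apply/asboolP; apply: ideal0.
- by apply/asboolP.
- move=> a u v /asboolP qu /asboolP qv; apply/asboolP.
  by apply: idealD => //; apply: idealM.
Qed.

Lemma prime_pred_prime q (pq : is_prime q) : prime_idealr_closed (prime_pred pq).
Proof.
move=> u v /asboolP quv; have [_ _ qM] := pq.
by apply/orP; case: (qM _ _ quv) => ?; [left|right]; apply/asboolP.
Qed.

HB.instance Definition _ q (pq : is_prime q) :=
  isIdealr.Build R (prime_pred pq) (prime_pred_idealr pq).
HB.instance Definition _ q (pq : is_prime q) :=
  isPrimeIdealrClosed.Build R (prime_pred pq) (@prime_pred_prime q pq).

Lemma prime_chain_of_upto r (p : nat -> R -> Prop) :
  prime_chain_upto r p -> exists p' : nat -> prime_idealr R, prime_chain r p'.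
Proof.
move=> [pP pS]; have pm i : is_prime (p (minn i r)) by apply: pP; apply: geq_minr.
exists (fun i => prime_pred (pm i) : prime_idealr R) => i lt.
have [sub [u u1 u0]] := pS i lt.
have E1 : minn i r = i by apply/minn_idPl/ltnW.
have E2 : minn i.+1 r = i.+1 by apply/minn_idPl.
split=> [v /asboolP pv|sub']; first by apply/asboolP; rewrite E2; rewrite E1 in pv; apply: sub.
have /asboolP : u \in prime_pred (pm i) by apply: sub'; apply/asboolP; rewrite E2.
by rewrite E1.
Qed.

Lemma is_prime_idealr (P : prime_idealr R) : is_prime (fun u => u \in P).
Proof.
split=> [||a b]; last by rewrite prime_idealrM => /orP.
  split=> [|a b|c a]; [exact: idealr0|exact: rpredD|exact: idealMr].
by rewrite idealr1.
Qed.

Lemma upto_of_prime_chain r (p : nat -> prime_idealr R) :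
  prime_chain r p -> prime_chain_upto r (fun i u => u \in p i).
Proof.
move=> pr; split=> [i _|i /pr[sub nsub]]; first exact: is_prime_idealr.
split; first exact: sub.
apply: contrapT => no; apply: nsub => u u1; apply: contrapT => u0.
by apply: no; exists u.
Qed.

End PrimeSeparation.

(** * Transfer to a localization *)

Section Transfer.
Variables (R B : comNzRingType) (psi : {rmorphism R -> B}) (I M : R -> Prop).
Implicit Types (J : R -> Prop) (s : seq R).
Hypothesis M_prime : is_prime M.
Hypothesis psi_ideal : forall a, I a -> psi a = 0.
Hypothesis psi_ker : forall a, psi a = 0 -> exists2 t, ~ M t & I (t * a).
Hypothesis psi_frac : forall y, exists t a, ~ M t /\ psi t * y = psi a.
Hypothesis psi_unit : forall t, ~ M t -> exists v, v * psi t = 1.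

(** The ideal of B generated by the image of J, with denominators outside M. *)
Definition extension J : B -> Prop :=
  fun y => exists t a, [/\ ~ M t, J a & psi t * y = psi a].

Lemma avoid1 : ~ M 1. Proof. by case: M_prime. Qed.

Lemma avoidM t t' : ~ M t -> ~ M t' -> ~ M (t * t').
Proof. by case: M_prime => _ _ MM nt nt' /MM[]. Qed.

Lemma psi_cancel t y y' : ~ M t -> psi t * y = psi t * y' -> y = y'.
Proof.
by move=> /psi_unit[v vt] E; rewrite -[y]mul1r -[y']mul1r -vt -!mulrA E.
Qed.

Lemma psi_inj a b : psi a = psi b -> exists2 t, ~ M t & I (t * (a - b)).
Proof. by move=> E; apply: psi_ker; rewrite rmorphB E subrr. Qed.

Lemma mem_extension J a : J a -> extension J (psi a).
Proof.
by exists 1, a; split=> //; [exact: avoid1|rewrite rmorph1 mul1r].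
Qed.

Lemma extension_ideal J : is_ideal J -> is_ideal (extension J).
Proof.
move=> iJ; split.
- by rewrite -(rmorph0 psi); apply: mem_extension; apply: ideal0.
- move=> y y' [t [a [nt Ja E]]] [t' [a' [nt' Ja' E']]].
  exists (t * t'), (t' * a + t * a'); split; first exact: avoidM.
    by apply: idealD => //; apply: idealM.
  by rewrite rmorphD !rmorphM /= -E -E'; ring.
- move=> c y [t [a [nt Ja E]]]; have [u [b [nu E']]] := psi_frac c.
  exists (t * u), (b * a); split; [exact: avoidM|exact: idealM|].
  by rewrite !rmorphM /= -E -E'; ring.
Qed.

Lemma extensionP J a : is_ideal J -> (forall u, I u -> J u) ->
  extension J (psi a) -> exists2 t, ~ M t & J (t * a).
Proof.
move=> iJ IJ [t [b [nt Jb]]]; rewrite -rmorphM => /psi_inj[u nu Iu].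
exists (u * t); first exact: avoidM.
have -> : u * t * a = u * (t * a - b) + u * b by ring.
by apply: idealD => //; [apply: IJ|apply: idealM].
Qed.

Lemma extension_adjoin J f : is_ideal J ->
  extension (adjoin J f) = adjoin (extension J) (psi f).
Proof.
move=> iJ; apply: set_ext => y; split.
  move=> [t [_ [nt [b [c [Jb ->]]] E]]]; have [v vt] := psi_unit nt.
  exists (v * psi b), (v * psi c); split.
    by apply: idealM; [apply: extension_ideal|apply: mem_extension].
  by rewrite -[y]mul1r -vt -mulrA E rmorphD rmorphM /=; ring.
move=> [y1 [c [Jy1 ->]]].
have iE := extension_ideal (adjoin_ideal f iJ).
apply: idealD => //.
  by case: Jy1 => t [a [nt Ja E]]; exists t, a; split=> //; apply: sub_adjoin.
apply: idealM => //; apply: mem_extension.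
by have := mem_adjoin f 1 iJ; rewrite mul1r.
Qed.

Lemma wregular_localize s J : is_ideal J -> (forall u, I u -> J u) ->
  wregular J s -> wregular (extension J) [seq psi f | f <- s].
Proof.
elim: s J => //= f s IH J iJ IJ [reg wreg]; split; last first.
  rewrite -extension_adjoin //; apply: IH => //; first exact: adjoin_ideal.
  by move=> u /IJ; apply: sub_adjoin.
move=> y Jfy; have [t [a [nt E]]] := psi_frac y.
have : extension J (psi (f * a)).
  rewrite rmorphM /= -E mulrCA; apply: idealM => //.
  exact: extension_ideal.
move=> /(extensionP iJ IJ)[u nu]; rewrite mulrCA => /reg Jua.
exists (u * t), (u * a); split=> //; first exact: avoidM.
by rewrite !rmorphM /= -E mulrA.
Qed.

Lemma extension_kernel : extension I = (fun y => y = 0).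
Proof.
apply: set_ext => y; split=> [[t [a [nt /psi_ideal a0 E]]]|->].
  by apply: (psi_cancel nt); rewrite E a0 mulr0.
have [t nt It] := psi_ker (rmorph0 psi).
exists 1, (t * 0); split=> //; first exact: avoid1.
by rewrite !mulr0 rmorph0.
Qed.

Lemma preimage_prime q : is_prime q -> is_prime (fun a => q (psi a)).
Proof.
move=> [iq q1 qM]; split=> [||a b]; rewrite ?rmorph1 ?rmorphM //; last exact: qM.
split=> [|a b|c a].
- by rewrite rmorph0; apply: ideal0.
- by rewrite rmorphD; apply: idealD.
- by rewrite rmorphM; apply: idealM.
Qed.

Lemma preimage_chain r (p : nat -> B -> Prop) :
  prime_chain_upto r p -> prime_chain_upto r (fun i a => p i (psi a)).
Proof.
move=> [pP pS]; split=> [i le|i lt]; first exact/preimage_prime/pP.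
have [sub [y y1 y0]] := pS i lt; split=> [u|]; first exact: sub.
have [[i0 _ _] [i1 _ _]] := (pP i (ltnW lt), pP i.+1 lt).
have [t [a [nt E]]] := psi_frac y; exists a; rewrite -E; first exact: idealM.
move=> pty; apply: y0; have [v vt] := psi_unit nt.
by rewrite -[y]mul1r -vt -mulrA; apply: idealM.
Qed.

Hypothesis I_sub_M : forall a, I a -> M a.

Lemma extension_prime : is_prime (extension M).
Proof.
have [iM M1 MM] := M_prime; split; first exact: extension_ideal.
  rewrite -(rmorph1 psi) => /(extensionP iM I_sub_M)[t nt].
  by rewrite mulr1.
move=> y y' Myy'.
have [t [a [nt E]]] := psi_frac y; have [t' [a' [nt' E']]] := psi_frac y'.
have : extension M (psi (a * a')).
  rewrite rmorphM /= -E -E' mulrACA; apply: idealM => //; exact: extension_ideal.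
move=> /(extensionP iM I_sub_M)[u nu /MM[//|/MM[Ma|Ma']]].
  by left; exists t, a.
by right; exists t', a'.
Qed.

Lemma extension_maximal (J : B -> Prop) y :
  is_ideal J -> ~ J 1 -> J y -> extension M y.
Proof.
move=> iJ J1 Jy; have [t [a [nt E]]] := psi_frac y; exists t, a; split=> //.
apply: contrapT => /psi_unit[v va]; apply: J1.
by rewrite -va -E; apply: (idealM _ iJ); apply: (idealM _ iJ).
Qed.

(** The sequence s gives depth at least d and, through its chain of primes,
    dimension at least d.  Chains in B restrict to chains in R above I, which
    bounds the dimension by d, and with it the length of regular sequences. *)
Lemma cohen_macaulay_local_transfer d (s : seq R) :
  is_ideal I -> wregular I s -> (forall f, f \in s -> M f) -> size s = d ->
  (forall r (p : nat -> R -> Prop), prime_chain_upto r p ->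
    (forall a, I a -> p 0%N a) -> (r <= d)%N) ->
  cohen_macaulay_local B.
Proof.
move=> iI wI sM sd dim.
have pm := extension_prime; have [im m1 _] := pm.
have wB : wregular (fun y => y = 0) [seq psi f | f <- s].
  by rewrite -extension_kernel; apply: wregular_localize.
have dimB r (p : nat -> B -> Prop) : prime_chain_upto r p -> (r <= d)%N.
  move=> pr; apply: (dim _ _ (preimage_chain pr)) => a /psi_ideal ->.
  by case: pr => /(_ 0%N isT)[ip _ _] _; apply: ideal0.
have chainB t : wregular (fun y => y = 0) t -> (forall y, y \in t -> extension M y) ->
    exists p : nat -> B -> Prop, prime_chain_upto (size t) p.
  move=> wt tm; have [|p [pt _ _]] := regular_prime_chain (@zero_ideal B) wt pm.
    apply: foldl_adjoin_min => // _ ->; exact: ideal0.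
  by exists p.
have sm y : y \in [seq psi f | f <- s] -> extension M y.
  by move=> /mapP[f fs ->]; apply/mem_extension/sM.
exists (prime_pred pm : idealr B).
  move=> J y Jy; apply/asboolP.
  apply: (@extension_maximal (fun u => u \in J)) Jy; last by rewrite idealr1.
  split=> [|a b|c a]; [exact: idealr0|exact: rpredD|exact: idealMr].
exists d; split.
- exists [seq psi f | f <- s]; split; last by rewrite size_map.
    apply/regular_sequenceP; split=> //; apply/negP => g1; apply: m1.
    by move: g1; apply: ideal_gen_min.
  by move=> y /sm ym; apply/asboolP.
- move=> t /regular_sequenceP[_ wt] tm.
  have [|p pt] := chainB t wt; last exact: dimB pt.
  by move=> y /tm/asboolP.
- have [p] := chainB _ wB sm; rewrite size_map sd; exact: prime_chain_of_upto.
- by move=> r p /upto_of_prime_chain/dimB.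
Qed.

End Transfer.

(** * Localizations, quotients and residue fields *)

Section LocalizationMap.
Variables (R : comNzRingType) (P : prime_idealr R).

Definition to_localization (a : R) : localization P := loc_frac a (loc_den1 P).

Lemma to_localization_zmod : zmod_morphism to_localization.
Proof.
move=> a b; rewrite /to_localization.
have -> : loc_frac a (loc_den1 P) - loc_frac b (loc_den1 P) =
  loc_add (loc_frac a (loc_den1 P)) (loc_opp (loc_frac b (loc_den1 P))) by [].
rewrite loc_oppE loc_addE; apply/loc_fracP; exists (loc_den1 P) => /=; ring.
Qed.

Lemma to_localization_monoid : monoid_morphism to_localization.
Proof.
split=> // a b; rewrite /to_localization.
have -> : loc_frac a (loc_den1 P) * loc_frac b (loc_den1 P) =
  loc_mul (loc_frac a (loc_den1 P)) (loc_frac b (loc_den1 P)) by [].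
rewrite loc_mulE; apply/loc_fracP; exists (loc_den1 P) => /=; ring.
Qed.

HB.instance Definition _ :=
  GRing.isZmodMorphism.Build R (localization P) to_localization to_localization_zmod.
HB.instance Definition _ :=
  GRing.isMonoidMorphism.Build R (localization P) to_localization
    to_localization_monoid.

Lemma to_localization_eq0 a :
  to_localization a = 0 -> exists2 t, t \notin P & t * a = 0.
Proof.
move=> /loc_fracP[u]; rewrite /= mul0r mulr0 mulr1 => ua.
by exists (sval u); first exact: (svalP u).
Qed.

Lemma to_localization_frac y :
  exists t a, t \notin P /\ to_localization t * y = to_localization a.
Proof.
elim/loc_fracW: y => a s; exists (sval s), a; split; first exact: (svalP s).
have -> : to_localization (sval s) * loc_frac a s =
  loc_mul (to_localization (sval s)) (loc_frac a s) by [].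
by rewrite loc_mulE; apply/loc_fracP; exists (loc_den1 P) => /=; ring.
Qed.

Lemma to_localization_unit t :
  t \notin P -> exists v, v * to_localization t = 1.
Proof.
move=> tP; exists (loc_frac 1 (exist _ t tP)).
have -> : loc_frac 1 (exist _ t tP) * to_localization t =
  loc_mul (loc_frac 1 (exist _ t tP)) (to_localization t) by [].
by rewrite loc_mulE; apply/loc_fracP; exists (loc_den1 P) => /=; ring.
Qed.

End LocalizationMap.

Section Quotients.
Variables (R : comNzRingType) (I : idealr R).

Lemma ideal_quot_eq0 a : (\pi_{ideal_quot I} a == 0) = (a \in I).
Proof.
by rewrite -[a in RHS]subr0 Quotient.idealrBE rmorph0.
Qed.

Lemma ideal_quot_surj (y : {ideal_quot I}) : exists a, y = \pi_{ideal_quot I} a.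
Proof. by exists (repr y); rewrite reprK. Qed.

End Quotients.

(** If a is not invertible modulo P, the ideal P + a is proper, hence contained
    in a prime ideal, which contradicts the maximality of P. *)
Lemma maximal_quotient_inverse (R : comNzRingType) (P : prime_idealr R) :
  maximal_ideal P -> forall y : {ideal_quot P}, y != 0 -> exists x, x * y = 1.
Proof.
move=> maxP y; have [a ->] := ideal_quot_surj y; rewrite ideal_quot_eq0 => aP.
have [iP _ _] := is_prime_idealr P.
have [[b [c [Pb E]]]|A1] := pselect (adjoin (fun u => u \in P) a 1).
  exists (\pi c); rewrite -rmorphM -[1](rmorph1 \pi_{ideal_quot P}).
  by apply/eqP; rewrite -Quotient.idealrBE E opprD addrCA subrr addr0 rpredN.
have [//|_ _ -> ->|u Aa E|p [pp Ap p1]] :=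
  @prime_separation _ _ (fun u => u = 1) (adjoin_ideal a iP).
- by rewrite mulr1.
- by apply: A1; rewrite -E.
case/negP: aP; apply: (maxP (prime_pred pp)).
  by move=> u uP; apply/asboolP/Ap/sub_adjoin.
by apply/asboolP/Ap; have := mem_adjoin a 1 iP; rewrite mul1r.
Qed.

Lemma algebraic_mod_maximal (k : fieldType) (B : comNzRingType)
    (f : {rmorphism k -> B}) u us :
  (forall y : B, y != 0 -> exists x, x * y = 1) -> generates f us ->
  exists2 g, g \is monic & (map_poly f g).[u] = 0.
Proof.
move=> invB gen.
have /choice[inv invP] : forall y : B, exists x, (y = 0 -> x = 0) /\ (y != 0 -> x * y = 1).
  move=> y; have [->|/invB[x xy]] := eqVneq y 0; first by exists 0.
  by exists x; split=> // y0; move: xy; rewrite y0 mulr0 => /eqP; rewrite eq_sym oner_eq0.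
have mulV (y : B) : y != 0 -> inv y * y = 1 by case: (invP y).
have inv0 : inv 0 = 0 by case: (invP 0) => ->.
pose K : fieldType := HB.pack (GRing.ComNzRing.sort B)
  (GRing.ComNzRing_isField.Build B mulV inv0).
apply: (@generated_algebraic K k f u us).
move=> Q Qf Qus; apply: gen => // v vus; apply: Qus; rewrite inE vus orbT //.
Qed.

(** * The symbolic square of a tight complex is Cohen-Macaulay *)

Section Polynomials.
Variables (k : fieldType) (n : nat).
Local Notation S := {mpoly k[n]}.

Lemma mpoly_generated (B : comNzRingType) (g : {rmorphism S -> B}) :
  (forall y, exists p, y = g p) ->
  generates (g \o @mpolyC n k) [seq g 'X_i | i <- enum 'I_n].
Proof.
move=> surj Q QC Qus QD QM y; have [p ->] := surj y.
have Q1 : Q 1 by have := QC 1; rewrite /= !rmorph1.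
rewrite [p]mpolyE rmorph_sum /=; apply: big_ind; [|exact: QD|].
  by have := QC 0; rewrite /= !rmorph0.
move=> m _; rewrite -mul_mpolyC rmorphM; apply: (QM); first exact: QC.
rewrite mpolyXE_id rmorph_prod; apply: big_ind; [exact: Q1|exact: QM|] => i _; rewrite rmorphXn.
elim: (m i) => [|e IH]; first by rewrite expr0.
by rewrite exprS; apply: QM => //; apply: Qus; apply: map_f; rewrite mem_enum.
Qed.

(** If no P_F is contained in q, choose for each F a monomial of P_F outside q;
    the product of their squares lies in every P_F^2 but not in q. *)
Lemma prime_contains_facet_ideal (fac : {set {set 'I_n}}) (q : S -> Prop) :
  is_prime q ->
  (forall u, monomial_ideal (standard fac set0 set0) u -> q u) ->
  exists2 F, F \in fac & forall u, monomial_ideal (supported F) u -> q u.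
Proof.
move=> [iq q1 qM] Iq; apply: contrapT => no.
have /choice[e eP] : forall F, exists m : 'X_{1..n},
    (F \in fac -> ~~ supported F m) /\ ~ q 'X_[m].
  move=> F; have [fF|fF] := boolP (F \in fac); last first.
    by exists 0%MM; split; [|rewrite mpolyX0].
  apply: contrapT => noe; apply: no; exists F => // u.
  apply: (monomial_ideal_min iq) => m mF; apply: contrapT => nq.
  by apply: noe; exists m.
have nqM a b : ~ q a -> ~ q b -> ~ q (a * b) by move=> na nb /qM[].
have : ~ q (\prod_(F in fac) ('X_[e F] * 'X_[e F])).
  by apply: (big_ind (fun u => ~ q u)) => // F _; apply: nqM; apply: (eP F).2.
apply; apply: Iq.
rewrite (eq_bigr (fun F => 'X_[e F + e F])) => [|F _]; last by rewrite mpolyXD.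
rewrite -(big_morph (fun m => 'X_[k, m]) (@mpolyXD n k) (@mpolyX0 n k)).
apply: monomial_idealX; apply/negP => /standardP[_ [F [fF _]]].
rewrite outside_weightE set0D cards0 addn0 leqNgt => /negP; apply.
have /forallPn[i] := (eP F).1 fF; rewrite negb_imply => /andP[iF].
rewrite (bigD1 i) //= mnm_sumE (bigD1 F) //= mnmDE; lia.
Qed.

End Polynomials.

Theorem theorem2p5 (k : fieldType) (n : nat) (D : simplicial_complex n) :
  tight D -> cohen_macaulay_ideal (symbolic_square k D).
Proof.
move=> [pureD [l tightD]].
have [F0 F0D] := facets_nonempty D; pose d := #|F0|.
have fac_card F : F \in facets D -> #|F| = d by move=> FD; apply: pureD.
pose I : idealr {mpoly k[n]} := symbolic_square k D.
pose piA : {rmorphism {mpoly k[n]} -> {ideal_quot I}} := \pi_{ideal_quot I}.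
pose J := monomial_ideal (k := k) (standard (facets D) set0 set0).
have iJ : is_ideal J by apply: monomial_idealP; apply: standard_order_ideal.
have quot0 p : (piA p = 0) <-> J p.
  apply: iff_trans (symbolic_squareP D p).
  by rewrite -(ideal_quot_eq0 I p); split=> [->|/eqP].
have genA := mpoly_generated (g := piA) (@ideal_quot_surj _ I).
split.
  apply: ideals_finitely_generated_noetherian.
  exact: (generated_ideals_finitely_generated (f := piA \o @mpolyC n k)
    (@field_ideals_finitely_generated k) genA).
move=> P maxP.
pose piK : {rmorphism {ideal_quot I} -> {ideal_quot P}} := \pi_{ideal_quot P}.
pose psi : {rmorphism {mpoly k[n]} -> localization P} := @to_localization {ideal_quot I} P \o piA.
pose phi : {rmorphism {mpoly k[n]} -> {ideal_quot P}} := piK \o piA.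
pose M p := piA p \in P.
have phi0 p : (phi p = 0) <-> M p.
  by rewrite /M -(ideal_quot_eq0 P); split=> [p0|/eqP //]; apply/eqP.
have phi_surj y : exists p, y = phi p.
  have [a ->] := ideal_quot_surj y; have [p ->] := ideal_quot_surj a.
  by exists p.
have invK : forall y : {ideal_quot P}, y != 0 -> exists x, x * y = 1 := maximal_quotient_inverse maxP.
have /choice[g gP] : forall i : 'I_n, exists g : {poly k}, g \is monic /\ M (eval_var i g).
  move=> i; have [g mg gi] := algebraic_mod_maximal (f := phi \o @mpolyC n k)
    (phi 'X_i) invK (mpoly_generated phi_surj).
  exists g; split=> //; apply/phi0; rewrite /eval_var -horner_map -map_poly_comp.
  exact: gi.
(* The factor X makes z_i vanish modulo P_F for i outside F, also when M does
   not contain P_F. *)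
pose g0 i : {poly k} := 'X * g i.
have g0_monic i : g0 i \is monic by rewrite monicMl ?monicX //; case: (gP i).
have g0_root i : root (g0 i) 0 by rewrite /root hornerM hornerX mul0r.
have pM : is_prime M by apply: (@preimage_prime _ _ piA (fun a => a \in P)); apply: is_prime_idealr.
have iM : is_ideal M by case: pM.
have zM i : M (eval_var i (g0 i)).
  by rewrite /eval_var rmorphM hornerM; apply: (idealM _ iM); case: (gP i).
have esM f : f \in esyms (fun i => eval_var i (g0 i)) d -> M f.
  elim: {1}d => //= j IH; rewrite inE => /orP[/eqP ->|]; last exact: IH.
  apply: (ideal_sum _ iM) => T /eqP cT; have [i iT] : exists i, i \in T.
    by apply/card_gt0P; rewrite cT.
  by rewrite (bigD1 i) //=; apply: (idealMl _ iM).
apply: (@cohen_macaulay_local_transfer _ _ psi J M pM _ _ _ _ _ d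
  (esyms (fun i => eval_var i (g0 i)) d)) => //.
- by move=> p /quot0 /= ->; rewrite rmorph0.
- move=> p /to_localization_eq0[t tP tp]; have [u uE] := ideal_quot_surj t.
  exists u; first by apply/negP; rewrite uE in tP.
  by apply/quot0; rewrite rmorphM; rewrite uE in tp.
- move=> y; have [t [a [tP E]]] := to_localization_frac y.
  have [u uE] := ideal_quot_surj t; have [b bE] := ideal_quot_surj a.
  exists u, b; split; first by apply/negP; rewrite uE in tP.
  by rewrite uE bE in E.
- by move=> t /negP/to_localization_unit.
- by move=> p /quot0 p0; rewrite /M p0 idealr0.
- apply: (@wregular_standard0 k n (facets D) l d) => // [G1 G2 i j G1D G2D|F FD].
    exact: tightD.
  rewrite -(fac_card F FD); exact: wregular_supported.
- suff sz j z : size (@esyms {mpoly k[n]} 'I_n z j) = j by [].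
  by elim: j => //= j ->.
- move=> r p pr Jp; have [p0 _] := pr.
  have [F FD FP] := prime_contains_facet_ideal (p0 0%N isT) Jp.
  rewrite -(fac_card F FD); exact: prime_chain_bound pr FP.
Qed.
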